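(* Let $T>0$ and suppose that $f\in\mathcal{A}_{T,\beta}$ for some $\beta>0$. Let $f$ be approximated, for positive even integers $N$, by the $N/2$-degree, $T$-periodic truncated Fourier series $$\Pi_N f(x)=\sum_{|k|\le N/2}\hat f_k\,e^{i\omega_k x},\qquad \hat f_k=\frac1T\int_0^T f(x)e^{-i\omega_k x}\,dx .$$ Then $$\|f-\Pi_N f\| = O\left(e^{-\omega_{N\beta/2}}\right)\quad\text{as } N\to\infty .$$ Moreover, if $f$ is $\beta$-analytic, then $$\|f-\Pi_N f\| = 0\quad\text{for all positive even integers } N,$$ i.e., $f\in\operatorname{span}\{e^{i\omega_k x}: k=-N/2,\dots,N/2\}$.
   Context: Notation: $\|\cdot\|$ is the $L^2([0,T])$ norm. $\omega_\alpha=\frac{2\pi\alpha}{T}$ for every real $\alpha$; thus $\omega_k=2\pi k/T$ and $\omega_{N\beta/2}=\pi N\beta/T$. For $\beta>0$, $\mathbf{C}_{T,\beta}=\{x+iy: x\in[0,T],\ y\in[-\beta,\beta]\}\subset\mathbb{C}$, and $\mathbf{C}_{T,\infty}=\{x+iy: x\in[0,T],\ y\in\mathbb{R}\}$. For $s\in\mathbb{Z}_{\ge 0}$, $\mathcal{H}_T^s$ is the set of $u$ in the Sobolev space $H^s([0,T])$ (derivatives up to order $s$ in $L^2$) such that $u^{(s)}$ is of bounded variation on $[0,T]$ and $u^{(j)}(0)=u^{(j)}(T)$ for $j=0,\dots,s-1$; $\mathcal{H}_T^\infty$ is the set of functions belonging to $\mathcal{H}_T^s$ for all $s$ (in particular $u^{(j)}(0)=u^{(j)}(T)$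 for all $j\ge0$). Functions are allowed to be complex-valued. $\mathcal{A}_{T,\beta}=\{u\in\mathcal{H}_T^\infty: u \text{ is analytic in some open set containing } \mathbf{C}_{T,\beta}\}$, with norm $\|u\|_{\mathcal{A}_{T,\beta}}=\|u\|_{L^\infty(\mathbf{C}_{T,\beta})}$. A function $u\in\mathcal{A}_{T,\beta}$ is called $\beta$-analytic if $u$ is analytic on $\mathbf{C}_{T,\infty}$ and $\lim_{\beta\to\infty}\frac{\|u\|_{\mathcal{A}_{T,\beta}}}{e^{\omega_\beta}}=0$ (in the limit, $\beta$ is a dummy variable tending to infinity). *)

(* Defs.v *)
From HB Require Import structures.
From mathcomp Require Import all_boot all_order all_algebra.
From mathcomp Require Export complex.
From mathcomp Require Import all_classical all_reals all_analysis.

Set Implicit Arguments.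
Unset Strict Implicit.
Unset Printing Implicit Defensive.

Import Order.TTheory GRing.Theory Num.Theory.
Import numFieldNormedType.Exports.

Local Open Scope classical_set_scope.
Local Open Scope complex_scope.
Local Open Scope ring_scope.

(* Complex numbers are R[i]; their topology is the one carried by R[i]^o.
   A function on [0, T] is a total function on R whose values outside [0, T]
   are ignored, and likewise for functions on a subset of the complex plane. *)

Section Fourier.
Context {R : realType}.
Implicit Types (T b : R) (u v : R -> R[i]) (f : R[i] -> R[i]).

Definition cabs (z : R[i]) : R := ComplexField.Normc.normc z.

Definition cis (t : R) : R[i] := cos t +i* sin t.

Definition omega T (a : R) : R := 2 * pi * a / T.

Definition cintegral T u : R[i] :=
  (\int[lebesgue_measure]_(x in `[0, T]) complex.Re (u x))
  +i* (\int[lebesgue_measure]_(x in `[0, T]) complex.Im (u x)).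

Definition L2norm T u : \bar R :=
  Lnorm lebesgue_measure 2%:E ((fun x => (cabs (u x))%:E) \_ `[0, T]).

Definition inL2 T u : Prop :=
  [/\ measurable_fun `[0, T] (fun x => complex.Re (u x)),
      measurable_fun `[0, T] (fun x => complex.Im (u x)) &
      (L2norm T u < +oo)%E].

Definition test_function T (phi : R -> R) : Prop :=
  (forall n x, derivable (derive1n n phi) x 1) /\
  exists a b, [/\ 0 < a, b < T & forall x, phi x != 0 -> a <= x <= b].

Definition weak_derivative T u v : Prop :=
  forall phi, test_function T phi ->
    cintegral T (fun x => u x * (derive1 phi x)%:C) =
    - cintegral T (fun x => v x * (phi x)%:C).

Definition complex_BV T u : Prop :=
  bounded_variation 0 T (fun x => complex.Re (u x)) /\ bounded_variation 0 T (fun x => complex.Im (u x)).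

(* D j is the j-th weak derivative of u.  Below order s it is represented by
   its continuous representative, which gives a meaning to the endpoint
   values. *)
Definition HT T (s : nat) u : Prop :=
  exists D : nat -> R -> R[i],
    [/\ {in `[0, T], D 0%N =1 u},
        forall j, (j <= s)%N -> inL2 T (D j),
        forall j, (j < s)%N -> weak_derivative T (D j) (D j.+1),
        complex_BV T (D s) &
        forall j, (j < s)%N ->
          {within `[0, T], continuous (D j : R -> R[i]^o)} /\
          D j 0 = D j T].

Definition HToo T u : Prop := forall s, HT T s u.

Definition strip T b : set R[i] :=
  [set z | 0 <= complex.Re z <= T /\ - b <= complex.Im z <= b].

Definition infinite_strip T : set R[i] := [set z | 0 <= complex.Re z <= T].

Definition analytic_in (U : set R[i]) f : Prop :=
  forall z, U z -> exists r (a : nat -> R[i]), 0 < r /\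
    forall w, cabs (w - z) < r ->
      series (fun n => a n * (w - z) ^+ n : R[i]^o) @ \oo --> (f w : R[i]^o).

Definition analytic_near (S : set R[i]) f : Prop :=
  exists U : set R[i]^o, [/\ open U, S `<=` U & analytic_in U f].

Definition inA T b f : Prop :=
  HToo T (fun x => f x%:C) /\ analytic_near (strip T b) f.

(* The L^infinity norm on the closed strip, identified with the rectangle
   [0, T] x [-b, b] equipped with the two-dimensional Lebesgue measure. *)
Definition Anorm T b f : \bar R :=
  Lnorm (lebesgue_measure \x lebesgue_measure)%E +oo%E
    ((fun p : R * R => (cabs (f (p.1 +i* p.2)))%:E)
       \_ (`[0, T] `*` `[- b, b])).

Definition beta_analytic T b f : Prop :=
  [/\ inA T b f,
      analytic_near (infinite_strip T) f &
      (Anorm T c f * ((expR (omega T c))^-1)%:E)%E @[c --> +oo] --> 0%E].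

Definition fourier_mode T (k : int) (x : R) : R[i] := cis (omega T k%:~R * x).

Definition fourier_coef T u (k : int) : R[i] :=
  (T^-1)%:C * cintegral T (fun x => u x * cis (- (omega T k%:~R * x))).

(* The index j < N.+1 stands for the frequency k = j - N/2, so that
   -N/2 <= k <= N/2 when N is even. *)
Definition freq (N : nat) (j : 'I_N.+1) : int := j%:Z - (N./2)%:Z.

Definition fourier_trunc T (N : nat) u (x : R) : R[i] :=
  \sum_(j < N.+1) fourier_coef T u (freq j) * fourier_mode T (freq j) x.

End Fourier.

(* Main.v *)
(** Take a smooth [T]-periodic [f], a point [x] of [(0, T)] and
    [q z = e^(2 pi i (z - x) / T)].  Since [(q - 1) sum_(|k| <= n) q^k = q^(n+1) - q^(-n)],
    the remainder [S_n f x - f x] is the mean over [[0, T]] of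
    [h (q^(n+1) - q^(-n))], where [h z = (f z - f x) / (q z - 1)].  When [f] is
    analytic on the strip of half-width [b], periodicity propagates from the real
    axis to the strip by the identity theorem, so the two terms can be integrated
    over the lines [Im z = b'] and [Im z = - b'] instead, for any [b' < b].
    There [|q^(n+1)|] and [|q^(-n) / (q - 1)|] are of order [e^(-2 pi (n+1) b' / T)],
    which bounds the remainder uniformly in [x].  The singularity of [h] at [x]
    is harmless, because it is bounded.  If [f] is analytic on the infinite strip and
    [o(e^(2 pi b / T))] on the strip of half-width [b], letting [b] grow kills the
    remainder for all [n >= 1]. *)

Require Import Defs.
From mathcomp Require Import all_boot all_order all_algebra.
From mathcomp Require Import complex.
From mathcomp Require Import all_classical all_reals all_analysis.
From mathcomp Require Import measurable_realfun ess_sup_inf.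
From mathcomp Require Import ring lra.
Import Order.TTheory GRing.Theory Num.Theory.
Import numFieldNormedType.Exports.
Local Open Scope classical_set_scope.
Local Open Scope complex_scope.
Local Open Scope ring_scope.

Set Implicit Arguments.
Unset Strict Implicit.
Unset Printing Implicit Defensive.

(** * Complex modulus and limits *)

(** Bounding the coefficients one by one would give the rate only once the Fourier series is known
    to converge to [f]; the closed formula for the remainder gives both at once. The contour shift
    is proved on horizontal segments, by differentiating the integral with respect to the height:
    under the integral this yields an exact derivative along the segment, so the result vanishes as
    soon as the integrand agrees at both ends. [f] is never extended beyond the strip. This confines
    [x] to the open interval, since for [x = 0] the function [q - 1] would vanish at both [0] and
    [T]; the endpoints are recovered by continuity. A large part of the work lies in the hypotheses.
    Periodicity is given through weak derivatives, in families that depend on the order. Testing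
    against smooth bumps identifies them with the complex derivatives, so that all derivatives of
    [f] agree at [0] and [T]; this is what the identity theorem needs to compare the two vertical
    edges. Likewise, growth is given by essential suprema, which have to become pointwise bounds on
    the closed strip. *)

Section ComplexModulus.
Context {R : realType}.
Implicit Types (u v w z : R[i]) (x y : R).

Lemma cabsE z : (cabs z)%:C = `|z|. Proof. by []. Qed.

Lemma cabs_ge0 z : 0 <= cabs z.
Proof. by rewrite -lecR cabsE normr_ge0. Qed.

Lemma cabs0 : cabs (0 : R[i]) = 0. Proof. exact: ComplexField.Normc.normc0. Qed.

Lemma cabs1 : cabs (1 : R[i]) = 1. Proof. exact: ComplexField.Normc.normc1. Qed.

Lemma cabsM u v : cabs (u * v) = cabs u * cabs v.
Proof. exact: ComplexField.Normc.normcM. Qed.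

Lemma cabsV z : cabs z^-1 = (cabs z)^-1.
Proof. exact: ComplexField.Normc.normcV. Qed.

Lemma cabsN z : cabs (- z) = cabs z. Proof. exact: normcN. Qed.

Lemma cabsX z n : cabs (z ^+ n) = cabs z ^+ n.
Proof. by elim: n => [|n ih]; rewrite ?expr0 ?cabs1// !exprS cabsM ih. Qed.

Lemma cabsD u v : cabs (u + v) <= cabs u + cabs v. Proof. exact: le_normcD. Qed.

Lemma cabsB u v : cabs (u - v) <= cabs u + cabs v.
Proof. by rewrite -(cabsN v) cabsD. Qed.

Lemma cabsC u v : cabs (u - v) = cabs (v - u).
Proof. by rewrite -cabsN opprB. Qed.

Lemma cabs_lerB u v : cabs u - cabs v <= cabs (u - v).
Proof. by rewrite lerBlDr -[u in X in X <= _](subrK v) cabsD. Qed.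

Lemma cabs_eq0 z : (cabs z == 0) = (z == 0).
Proof. by apply/eqP/eqP => [/ComplexField.Normc.eq0_normc//|->]; rewrite cabs0. Qed.

Lemma cabs_gt0 z : (0 < cabs z) = (z != 0).
Proof. by rewrite lt_neqAle cabs_ge0 andbT eq_sym cabs_eq0. Qed.

Lemma cabsR x : cabs x%:C = `|x|.
Proof. by rewrite /cabs /= expr0n addr0 sqrtr_sqr. Qed.

Lemma cabs_nat n : cabs (n%:R : R[i]) = n%:R.
Proof.
have -> : n%:R = (n%:R : R)%:C :> R[i] by rewrite rmorph_nat.
by rewrite cabsR normr_nat.
Qed.

Lemma cabs_i : cabs ('i%C : R[i]) = 1.
Proof. by rewrite /cabs /= expr0n expr1n add0r sqrtr1. Qed.

Lemma Re_le_cabs z : `|complex.Re z| <= cabs z.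
Proof. by rewrite -lecR cabsE normc_ge_Re. Qed.

Lemma ReNi z : complex.Re (- 'i%C * z) = complex.Im z.
Proof. by case: z => a b; simpc. Qed.

Lemma Im_le_cabs z : `|complex.Im z| <= cabs z.
Proof. by rewrite -ReNi (le_trans (Re_le_cabs _))// cabsM cabsN cabs_i mul1r. Qed.

Lemma cabs_le z : cabs z <= `|complex.Re z| + `|complex.Im z|.
Proof.
rewrite {1}[z]complexE (le_trans (cabsD _ _))//.
by rewrite cabsM cabs_i mul1r !cabsR.
Qed.

Lemma cabs_sum (I : Type) (r : seq I) (P : pred I) (F : I -> R[i]) :
  cabs (\sum_(i <- r | P i) F i) <= \sum_(i <- r | P i) cabs (F i).
Proof.
elim/big_ind2: _ => // [|x a y b xa yb]; first by rewrite cabs0.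
by rewrite (le_trans (cabsD _ _))// lerD.
Qed.

Lemma ReD u v : complex.Re (u + v) = complex.Re u + complex.Re v.
Proof. by case: u v => ? ? []. Qed.

Lemma ImD u v : complex.Im (u + v) = complex.Im u + complex.Im v.
Proof. by case: u v => ? ? []. Qed.

Lemma ReB u v : complex.Re (u - v) = complex.Re u - complex.Re v.
Proof. by case: u v => ? ? []. Qed.

Lemma ImB u v : complex.Im (u - v) = complex.Im u - complex.Im v.
Proof. by case: u v => ? ? []. Qed.

Lemma ReZ x z : complex.Re (x%:C * z) = x * complex.Re z.
Proof. by case: z => ? ?; simpc. Qed.

Lemma ImZ x z : complex.Im (x%:C * z) = x * complex.Im z.
Proof. by case: z => ? ?; simpc. Qed.

Lemma complex_eq u v :
  complex.Re u = complex.Re v -> complex.Im u = complex.Im v -> u = v.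
Proof. by case: u v => ? ? [] ? ? /= -> ->. Qed.

Lemma cabs_small_eq u v : (forall e, 0 < e -> cabs (u - v) <= e) -> u = v.
Proof.
move=> h; apply/eqP; rewrite -subr_eq0 -cabs_eq0 eq_le cabs_ge0 andbT.
by apply/ler_addgt0Pr => e e0; rewrite add0r h.
Qed.

End ComplexModulus.

Section ComplexLimits.
Context {R : realType}.
Implicit Types (s t : nat -> R[i]) (l m : R[i]).

Definition clim s l : Prop :=
  forall e : R, 0 < e -> exists N, forall n, (N <= n)%N -> cabs (s n - l) < e.

Lemma cvg_clim s l : (s : nat -> R[i]^o) @ \oo --> (l : R[i]^o) -> clim s l.
Proof.
move=> /cvgrPdist_lt h e e0.
have /h [N _ hN] : (0 : R[i]) < e%:C by rewrite ltcR.
exists N => n /hN /=; rewrite -normrN opprB -cabsE ltcR; exact.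
Qed.

Lemma climB s t l m : clim s l -> clim t m -> clim (fun n => s n - t n) (l - m).
Proof.
move=> sl tm e e0.
have e2 : 0 < e / 2 by rewrite divr_gt0.
have [N1 h1] := sl _ e2; have [N2 h2] := tm _ e2.
exists (maxn N1 N2) => n; rewrite geq_max => /andP[/h1 a /h2 b].
have -> : s n - t n - (l - m) = (s n - l) - (t n - m) by ring.
by rewrite (le_lt_trans (cabsB _ _))// (splitr e) ltrD.
Qed.

Lemma climZ c s l : clim s l -> clim (fun n => c * s n) (c * l).
Proof.
move=> sl e e0.
have c1 : 0 < cabs c + 1 by rewrite ltr_wpDl ?cabs_ge0.
have [N h] := sl _ (divr_gt0 e0 c1).
exists N => n /h hn; rewrite -mulrBr cabsM.
have : (cabs c + 1) * cabs (s n - l) < e by rewrite mulrC -ltr_pdivlMr.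
apply: le_lt_trans; rewrite ler_wpM2r ?cabs_ge0// lerDl//.
Qed.

Lemma clim_bound s l K : (forall n, cabs (s n) <= K) -> clim s l -> cabs l <= K.
Proof.
move=> sK sl; apply/ler_addgt0Pr => e e0.
have [N /(_ N (leqnn N)) h] := sl _ e0.
have -> : l = s N - (s N - l) by ring.
by rewrite (le_trans (cabsB _ _))// lerD// ltW.
Qed.

Lemma clim_unique s l m : clim s l -> clim s m -> l = m.
Proof.
move=> sl sm; apply/esym; apply: cabs_small_eq => e e0.
have := climB sl sm => /(clim_bound (K := 0)).
rewrite cabsC => h; apply: le_trans (ltW e0); apply: h => n.
by rewrite subrr cabs0.
Qed.

Lemma series_abs_cvg (c : nat -> R) (K : R) :
  (forall n, \sum_(k < n) `|c k| <= K) ->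
  exists l : R, series c @ \oo --> l.
Proof.
move=> cK.
have h : cvgn (series (fun k => `|c k|)).
  apply: nondecreasing_is_cvgn.
    apply/nondecreasing_seqP => n.
    by rewrite seriesSr lerDl.
  exists K => _ [n _ <-].
  by rewrite seriesEord /=; exact: cK.
by have /normed_cvg/cvg_ex := h.
Qed.

Lemma cseries_abs_clim (c : nat -> R[i]) (K : R) :
  (forall n, \sum_(k < n) cabs (c k) <= K) ->
  exists l, clim (fun n => \sum_(k < n) c k) l.
Proof.
move=> cK.
have [a ha] : exists l : R, series (fun k => complex.Re (c k)) @ \oo --> l.
  apply: (series_abs_cvg (K := K)) => n; apply: le_trans (cK n).
  by apply: ler_sum => i _; exact: Re_le_cabs.
have [b hb] : exists l : R, series (fun k => complex.Im (c k)) @ \oo --> l.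
  apply: (series_abs_cvg (K := K)) => n; apply: le_trans (cK n).
  by apply: ler_sum => i _; exact: Im_le_cabs.
exists (a +i* b) => e e0.
have e2 : 0 < e / 2 by rewrite divr_gt0.
have /cvgrPdist_lt /(_ _ e2) [N1 _ h1] := ha.
have /cvgrPdist_lt /(_ _ e2) [N2 _ h2] := hb.
exists (maxn N1 N2) => n; rewrite geq_max => /andP[/h1 /= a1 /h2 /= b1].
apply: (le_lt_trans (cabs_le _)); rewrite ReB ImB /= (splitr e).
have -> : complex.Re (\sum_(k < n) c k) = series (fun k => complex.Re (c k)) n.
  rewrite /series /= big_mkord; elim/big_rec2: _ => //= i x y _ <-.
  by rewrite ReD.
have -> : complex.Im (\sum_(k < n) c k) = series (fun k => complex.Im (c k)) n.
  rewrite /series /= big_mkord; elim/big_rec2: _ => //= i x y _ <-.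
  by rewrite ImD.
by rewrite ltrD// distrC.
Qed.

End ComplexLimits.

(** * Power series and their derivatives *)

Section PowerSeries.
Context {R : realType}.
Implicit Types (f F G : R[i] -> R[i]) (a : nat -> R[i]) (z w h d u : R[i]).

(* Complex differentiability, stated with the real-valued modulus so that the
   topology of [R[i]^o] is only met in the hypotheses of the theorem. *)
Definition hol f z d : Prop := forall e : R, 0 < e ->
  exists2 D : R, 0 < D &
    forall h, cabs h < D -> cabs (f (z + h) - f z - d * h) <= e * cabs h.

Definition has_series f z a (r : R) : Prop := forall w, cabs (w - z) < r ->
  clim (fun n => \sum_(k < n) a k * (w - z) ^+ k) (f w).

Definition series_derive a (n : nat) : R[i] := n.+1%:R * a n.+1.

Lemma clim_shift (s : nat -> R[i]) l : clim s l -> clim (fun n => s n.+1) l.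
Proof.
move=> sl e /sl[N h]; exists N => n Nn; apply: h; exact: leq_trans (leqnSn n).
Qed.

Lemma hol_unique f z d d' : hol f z d -> hol f z d' -> d = d'.
Proof.
move=> h h'; apply: cabs_small_eq => e e0.
have e2 : 0 < e / 2 by rewrite divr_gt0.
have [D D0 hD] := h _ e2; have [D' D'0 hD'] := h' _ e2.
pose m := Num.min D D'; pose x := m / 2.
have m0 : 0 < m by rewrite lt_min D0.
have x0 : 0 < x by rewrite divr_gt0.
have [xD xD'] : x < D /\ x < D'.
  have : x < m by rewrite /x ltr_pdivrMr// ltr_pMr// ltr1n.
  by rewrite lt_min => /andP[].
have cx : cabs (x%:C : R[i]) = x by rewrite cabsR gtr0_norm.
have H1 : cabs (f (z + x%:C) - f z - d * x%:C) <= e / 2 * x.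
  by rewrite -[X in _ <= _ * X]cx; apply: hD; rewrite cx.
have H2 : cabs (f (z + x%:C) - f z - d' * x%:C) <= e / 2 * x.
  by rewrite -[X in _ <= _ * X]cx; apply: hD'; rewrite cx.
rewrite -(ler_pM2r x0) -{1}cx -cabsM.
have -> : (d - d') * x%:C = (f (z + x%:C) - f z - d' * x%:C) -
   (f (z + x%:C) - f z - d * x%:C) by ring.
by rewrite (le_trans (cabsB _ _))//; apply: le_trans (lerD H2 H1) _; lra.
Qed.

(** A term of the series at [z + rho] is the difference of two consecutive partial sums, and these
    converge. *)
Lemma has_series_coef_bound f z a r (rho : R) :
  has_series f z a r -> 0 < rho -> rho < r ->
  exists2 M : R, 0 <= M & forall k, cabs (a k) * rho ^+ k <= M.
Proof.
move=> fa rho0 rhor.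
have zE : z + rho%:C - z = rho%:C by rewrite addrC addKr.
have c : cabs (z + rho%:C - z) < r by rewrite zE cabsR gtr0_norm.
have [N hN] := fa _ c 1 ltr01.
have tE k : cabs (a k * rho%:C ^+ k) = cabs (a k) * rho ^+ k.
  by rewrite cabsM cabsX cabsR gtr0_norm.
(* From [N] on, both partial sums are within 1 of the limit, hence the 2; the earlier terms are
   bounded by their sum. *)
exists (2 + \sum_(k < N) cabs (a k) * rho ^+ k).
  by rewrite addr_ge0// sumr_ge0// => i _; rewrite mulr_ge0 ?cabs_ge0 ?exprn_ge0 ?ltW.
move=> k; have [kN|Nk] := ltnP k N.
  rewrite (bigD1 (Ordinal kN))//= addrCA lerDl addr_ge0// sumr_ge0// => i _.
  by rewrite mulr_ge0 ?cabs_ge0 ?exprn_ge0 ?ltW.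
apply: (@le_trans _ _ 2); last first.
  rewrite lerDl sumr_ge0// => i _.
  by rewrite mulr_ge0 ?cabs_ge0 ?exprn_ge0 ?ltW.
have := hN k Nk; have := hN k.+1 (leq_trans Nk (leqnSn k)).
rewrite zE big_ord_recr/= -tE.
set s := \sum_(_ < _) _; set l := f _ => h1 h2.
have -> : a k * rho%:C ^+ k = (s + a k * rho%:C ^+ k - l) - (s - l) by ring.
by rewrite (le_trans (cabsB _ _))//; lra.
Qed.

(** Second-order Taylor bound for the [k]-th power. The remainders satisfy
    [X_(k+1) = (u + h) X_k + k u^(k-1) h^2], whence the induction. The factor [s ^+ 2] on the left
    avoids the exponent [k - 2], and at [k = 0] the truncated exponent [k.-1] is multiplied by 0. *)
Lemma exprD_linear_rest u h (s : R) k : cabs u <= s -> cabs (u + h) <= s ->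
  cabs ((u + h) ^+ k - u ^+ k - k%:R * u ^+ k.-1 * h) * s ^+ 2 <=
    k%:R ^+ 2 * s ^+ k * cabs h ^+ 2.
Proof.
move=> us uhs; have s0 : 0 <= s by rewrite (le_trans _ us)// cabs_ge0.
elim: k => [|k ih]; first by rewrite !expr0 subrr !mul0r subrr cabs0 mulr0n expr0n !mul0r.
have -> : (u + h) ^+ k.+1 - u ^+ k.+1 - k.+1%:R * u ^+ k.+1.-1 * h =
    (u + h) * ((u + h) ^+ k - u ^+ k - k%:R * u ^+ k.-1 * h) +
    k%:R * u ^+ k.-1 * h ^+ 2.
  case: k {ih} => [|k]; first by rewrite !expr0 !expr1 /=; ring.
  by rewrite /= !exprS -!natr1; ring.
set X := (_ - _ in X in cabs (_ * X + _)) in ih *.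
have A : cabs ((u + h) * X) * s ^+ 2 <= s * (k%:R ^+ 2 * s ^+ k * cabs h ^+ 2).
  rewrite cabsM -mulrA; apply: ler_pM => //; first exact: cabs_ge0.
  by rewrite mulr_ge0 ?cabs_ge0 ?exprn_ge0.
have B : cabs (k%:R * u ^+ k.-1 * h ^+ 2) * s ^+ 2 <=
    k%:R * s ^+ k.+1 * cabs h ^+ 2.
  rewrite !cabsM !cabsX cabs_nat.
  case: k {ih X A} => [|k]; first by rewrite !mul0r.
  rewrite mulrAC; apply: ler_wpM2r; first by rewrite mulr_ge0 ?cabs_ge0.
  rewrite -mulrA; apply: ler_wpM2l => //=.
  have -> : s ^+ k.+2 = s ^+ k * s ^+ 2 by rewrite -exprD addn2.
  apply: ler_wpM2r; first exact: exprn_ge0.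
  by apply: lerXn2r; rewrite ?nnegrE ?cabs_ge0.
apply: (@le_trans _ _ ((cabs ((u + h) * X) +
    cabs (k%:R * u ^+ k.-1 * h ^+ 2)) * s ^+ 2)).
  by apply: ler_wpM2r; [exact: exprn_ge0|exact: cabsD].
rewrite mulrDl; apply: le_trans (lerD A B) _.
rewrite -natr1 ![s ^+ k.+1]exprS -subr_ge0.
have -> : (k%:R + 1) ^+ 2 * (s * s ^+ k) * cabs h ^+ 2 -
  (s * (k%:R ^+ 2 * s ^+ k * cabs h ^+ 2) + k%:R * (s * s ^+ k) * cabs h ^+ 2) =
  (k%:R + 1) * (s * s ^+ k * cabs h ^+ 2) by ring.
by rewrite !mulr_ge0 ?exprn_ge0 ?cabs_ge0 ?addr_ge0.
Qed.

Lemma sum_sqr_geometric (t : R) n : 0 <= t < 1 ->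
  \sum_(k < n) k%:R ^+ 2 * t ^+ k <= 2 / (1 - t) ^+ 3.
Proof.
move=> /andP[t0 t1]; have u0 : 0 < 1 - t by rewrite subr_gt0.
(* [P k] majorizes the tail sum of [(k + j)^2 t^j] over [j]. By [PS], the partial sum plus [t^n P n]
   does not increase with [n], so it stays below [P 0]. *)
pose P k : R := k%:R ^+ 2 / (1 - t) + 2 * k%:R / (1 - t) ^+ 2 + 2 / (1 - t) ^+ 3.
have PS k : k%:R ^+ 2 + t * P k.+1 <= P k.
  rewrite -subr_ge0.
  have -> : P k - (k%:R ^+ 2 + t * P k.+1) = 2 * k%:R + (2 - t) / (1 - t).
    rewrite /P -natr1; field; lra.
  by rewrite addr_ge0 ?mulr_ge0// ?invr_ge0; lra.
have P0 k : 0 <= P k.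
  by rewrite !addr_ge0// !mulr_ge0// ?invr_ge0 ?exprn_ge0// ltW.
suff : \sum_(k < n) k%:R ^+ 2 * t ^+ k + t ^+ n * P n <= P 0%N.
  rewrite /P expr0n mul0r mulr0 mul0r !add0r; apply: le_trans.
  by rewrite lerDl; apply: mulr_ge0; [exact: exprn_ge0|exact: P0].
elim: n => [|n ih]; first by rewrite big_ord0 add0r expr0 mul1r.
apply: le_trans ih; rewrite big_ord_recr /= -addrA lerD2l [t ^+ n.+1]exprS.
apply: le_trans (ler_wpM2l (exprn_ge0 n t0) (PS n)).
by rewrite [leRHS](_ : _ = n%:R ^+ 2 * t ^+ n + t * t ^+ n * P n.+1)//; ring.
Qed.

(** Term-by-term differentiation. The second-order remainders of the powers are summed against a
    geometric majorant of the coefficients, which bounds the remainder of [f] by a multiple of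
    [|h|^2]. *)
Lemma has_series_derive f z a r w : has_series f z a r -> cabs (w - z) < r ->
  exists2 d, hol f w d &
    clim (fun n => \sum_(k < n) series_derive a k * (w - z) ^+ k) d.
Proof.
move=> fa wr; pose u := w - z.
(* [s] and [rho] trisect the segment from [|u|] to [r]: the coefficients are bounded at radius
   [rho], the powers at radius [s], and the gap gives the ratio [t < 1]. *)
pose s := (2 * cabs u + r) / 3; pose rho := (cabs u + 2 * r) / 3.
have u0 : 0 <= cabs u := cabs_ge0 u.
have us : cabs u < s by rewrite /s /u; lra.
have srho : s < rho by rewrite /s /rho /u; lra.
have rhor : rho < r by rewrite /rho /u; lra.
have s0 : 0 < s := le_lt_trans u0 us.
clearbody s rho.
have rho0 : 0 < rho := lt_trans s0 srho.
have [M M0 aM] := has_series_coef_bound fa rho0 rhor.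
pose t := s / rho.
have t01 : 0 <= t < 1 by rewrite divr_ge0 ?ltW//= /t ltr_pdivrMr// mul1r.
have as_ k : cabs (a k) * s ^+ k <= M * t ^+ k.
  have -> : s ^+ k = t ^+ k * rho ^+ k by rewrite -exprMn divfK// gt_eqF.
  rewrite mulrCA mulrC; apply: ler_wpM2r => //.
  by rewrite exprn_ge0//; case/andP: t01.
pose K := 2 / (1 - t) ^+ 3.
have [d hd] : exists d,
    clim (fun n => \sum_(k < n) series_derive a k * u ^+ k) d.
  apply: (@cseries_abs_clim _ (fun k => series_derive a k * u ^+ k) (M / s * K)) => n.
  (* Bounding [k] by [k^2] lets the sum needed for the remainder serve for the derived series
     too. *)
  apply: (@le_trans _ _ (M / s * \sum_(k < n.+1) k%:R ^+ 2 * t ^+ k)); last first.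
    by apply: ler_wpM2l; [rewrite divr_ge0// ltW|exact: sum_sqr_geometric].
  rewrite big_ord_recl /= expr0n mul0r add0r mulr_sumr; apply: ler_sum => k _.
  rewrite /series_derive !cabsM cabs_nat cabsX.
  apply: (@le_trans _ _ (k.+1%:R * cabs (a k.+1) * s ^+ k)).
    apply: ler_wpM2l; first by rewrite mulr_ge0 ?cabs_ge0.
    by apply: lerXn2r; rewrite ?nnegrE// ltW.
  have -> : k.+1%:R * cabs (a k.+1) * s ^+ k =
      k.+1%:R / s * (cabs (a k.+1) * s ^+ k.+1).
    by rewrite exprS; field; exact: lt0r_neq0.
  apply: (@le_trans _ _ (k.+1%:R / s * (M * t ^+ k.+1))).
    by apply: ler_wpM2l; rewrite ?divr_ge0// ltW.
  rewrite /bump /= add1n.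
  have -> : k.+1%:R / s * (M * t ^+ k.+1) = k.+1%:R * (M / s * t ^+ k.+1) by ring.
  have -> : M / s * (k.+1%:R ^+ 2 * t ^+ k.+1) =
    k.+1%:R ^+ 2 * (M / s * t ^+ k.+1) by ring.
  apply: ler_wpM2r; last by rewrite expr2 ler_peMr// ler1n.
  have /andP[t0 _] := t01.
  by apply: mulr_ge0; [rewrite divr_ge0// ltW|exact: exprn_ge0].
exists d => //.
pose K2 := M * K / s ^+ 2.
have K0 : 0 <= K.
  have /andP[_ /ltW t1] := t01.
  by apply: divr_ge0 => //; apply: exprn_ge0; rewrite subr_ge0.
have K20 : 0 <= K2 by apply: divr_ge0; [exact: mulr_ge0|exact/exprn_ge0/ltW].
have quad h : cabs h < s - cabs u ->
    cabs (f (w + h) - f w - d * h) <= K2 * cabs h ^+ 2.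
  move=> hs.
  have uhs : cabs (u + h) <= s by rewrite (le_trans (cabsD _ _))//; lra.
  have whE : w + h - z = u + h by rewrite /u addrAC.
  have whr : cabs (w + h - z) < r by rewrite whE; lra.
  (* The shift pairs [n + 1] terms of [f] with [n] terms of the derived series, since
     differentiation kills the constant term. *)
  have := climB (climB (clim_shift (fa _ whr)) (clim_shift (fa _ wr))) (climZ h hd).
  rewrite (mulrC h d) => /(clim_bound (K := K2 * cabs h ^+ 2)); apply => n.
  rewrite whE -/u.
  have -> : \sum_(k < n.+1) a k * (u + h) ^+ k - \sum_(k < n.+1) a k * u ^+ k -
      h * (\sum_(k < n) series_derive a k * u ^+ k) =
      \sum_(k < n.+1) a k * ((u + h) ^+ k - u ^+ k - k%:R * u ^+ k.-1 * h).
    have -> : h * (\sum_(k < n) series_derive a k * u ^+ k) =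
        \sum_(k < n.+1) a k * (k%:R * u ^+ k.-1 * h).
      rewrite big_ord_recl /= !mul0r mulr0 add0r mulr_sumr; apply: eq_bigr => k _.
      by rewrite /series_derive /bump /= add1n; ring.
    by rewrite -!sumrB; apply: eq_bigr => k _; rewrite !mulrBr.
  apply: le_trans (cabs_sum _ _ _) _.
  have -> : K2 * cabs h ^+ 2 = M * cabs h ^+ 2 / s ^+ 2 * K.
    by rewrite /K2; ring.
  apply: le_trans (ler_wpM2l _ (sum_sqr_geometric n.+1 t01)); last first.
    apply: divr_ge0; last exact/exprn_ge0/ltW.
    by apply: mulr_ge0 => //; apply: exprn_ge0; exact: cabs_ge0.
  rewrite mulr_sumr; apply: ler_sum => k _; rewrite cabsM.
  rewrite [leRHS]mulrAC ler_pdivlMr ?exprn_gt0// -[leLHS]mulrA.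
  apply: le_trans (ler_wpM2l (cabs_ge0 _) (exprD_linear_rest k (ltW us) uhs)) _.
  have -> : M * cabs h ^+ 2 * (k%:R ^+ 2 * t ^+ k) =
    (k%:R ^+ 2 * cabs h ^+ 2) * (M * t ^+ k) by ring.
  have -> : cabs (a k) * (k%:R ^+ 2 * s ^+ k * cabs h ^+ 2) =
    (k%:R ^+ 2 * cabs h ^+ 2) * (cabs (a k) * s ^+ k) by ring.
  apply: ler_wpM2l => //; apply: mulr_ge0; apply: exprn_ge0 => //.
  exact: cabs_ge0.
move=> e e0; pose D := Num.min (s - cabs u) (e / (K2 + 1)).
have K21 : 0 < K2 + 1 by rewrite ltr_wpDl.
exists D; first by rewrite lt_min subr_gt0 us divr_gt0.
move=> h; rewrite lt_min => /andP[/quad hq he].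
apply: le_trans hq _; rewrite expr2 mulrA; apply: ler_wpM2r; first exact: cabs_ge0.
move: he; rewrite ltr_pdivlMr// => he; apply: le_trans (ltW he).
by rewrite mulrC ler_wpM2l ?cabs_ge0// lerDl.
Qed.

(** A total function, with value 0 where no derivative exists, so that it can be iterated. *)
Definition cderive f z : R[i] := xget 0 [set d | hol f z d].

Lemma hol_cderive f z d : hol f z d -> cderive f z = d.
Proof.
move=> h; rewrite /cderive; case: xgetP => [d' _ h'|/(_ d)//].
exact: hol_unique h' h.
Qed.

Lemma has_series_hol f z a r w : has_series f z a r -> cabs (w - z) < r ->
  hol f w (cderive f w).
Proof.
by move=> fa wr; have [d h _] := has_series_derive fa wr; rewrite (hol_cderive h).
Qed.

Lemma has_series_cderive f z a r : has_series f z a r ->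
  has_series (cderive f) z (series_derive a) r.
Proof.
move=> fa w wr; have [d h cl] := has_series_derive fa wr.
by rewrite (hol_cderive h).
Qed.

Lemma has_series_iter_cderive f z a r j : has_series f z a r ->
  has_series (iter j cderive f) z (iter j series_derive a) r.
Proof. by move=> fa; elim: j => //= j; exact: has_series_cderive. Qed.

Lemma iter_series_derive0 a j : iter j series_derive a 0%N = j`!%:R * a j.
Proof.
(* Each derivation shifts the index, so the induction on [j] needs every coefficient and not only
   the one at 0. *)
suff H n : n`!%:R * iter j series_derive a n = (n + j)`!%:R * a (n + j)%N.
  by have := H 0%N; rewrite fact0 mul1r add0n.
elim: j n => [|j ih] n; first by rewrite addn0.
rewrite /= /series_derive mulrA mulrC -natrM mulnC -factS.
by rewrite mulrC ih addSnnS.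
Qed.

Lemma has_series_center f z a r : 0 < r -> has_series f z a r -> f z = a 0%N.
Proof.
move=> r0 fa; have c : cabs (z - z) < r by rewrite subrr cabs0.
apply: (clim_unique (clim_shift (fa z c))) => e e0; exists 0%N => n _.
rewrite subrr big_ord_recl expr0 mulr1 big1 ?addr0 ?subrr ?cabs0// => i _.
by rewrite expr0n mulr0.
Qed.

Lemma iter_cderive_center f z a r j : 0 < r -> has_series f z a r ->
  iter j cderive f z = j`!%:R * a j.
Proof.
move=> r0 fa; rewrite (has_series_center r0 (has_series_iter_cderive j fa)).
exact: iter_series_derive0.
Qed.

Lemma analytic_in_has_series (U : set R[i]) f z : analytic_in U f -> U z ->
  exists r a, 0 < r /\ has_series f z a r.
Proof.
move=> fU /fU[r [a [r0 h]]]; exists r, a; split => // w /h /cvg_clim hw e /hw[N hN].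
by exists N => n /hN; rewrite /series /= big_mkord.
Qed.

(* Analyticity in the form preserved by [cderive]. *)
Definition has_series_on (U : set R[i]) f :=
  forall z, U z -> exists r a, 0 < r /\ has_series f z a r.

Lemma has_series_on_iter (U : set R[i]) f j : has_series_on U f ->
  has_series_on U (iter j cderive f).
Proof.
move=> fU z /fU[r [a [r0 h]]]; exists r, (iter j series_derive a).
by split => //; exact: has_series_iter_cderive.
Qed.

Lemma has_series_on_hol (U : set R[i]) f z : has_series_on U f -> U z ->
  hol f z (cderive f z).
Proof.
move=> fU /fU[r [a [r0 h]]]; apply: has_series_hol h _.
by rewrite subrr cabs0.
Qed.

(** Local form of the identity theorem, comparing [f] at two centers: the derivatives determine the
    coefficients, so both points have the same expansion. *)
Lemma iter_cderive_eq_near f z w : (exists r a, 0 < r /\ has_series f z a r) ->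
  (exists r a, 0 < r /\ has_series f w a r) ->
  (forall j, iter j cderive f z = iter j cderive f w) ->
  exists2 r : R, 0 < r & forall h, cabs h < r ->
    forall j, iter j cderive f (z + h) = iter j cderive f (w + h).
Proof.
move=> [r [a [r0 ha]]] [r' [b [r'0 hb]]] zw.
have ab : a = b.
  apply/funext => j; have := zw j.
  rewrite (iter_cderive_center j r0 ha) (iter_cderive_center j r'0 hb).
  by apply: mulfI; rewrite pnatr_eq0 -lt0n fact_gt0.
exists (Num.min r r'); first by rewrite lt_min r0.
move=> h; rewrite lt_min => /andP[hr hr'] j.
have e1 : z + h - z = h by ring.
have e2 : w + h - w = h by ring.
have := @has_series_iter_cderive _ _ _ _ j ha (z + h).
have := @has_series_iter_cderive _ _ _ _ j hb (w + h).
rewrite e1 e2 ab => /(_ hr') H1 /(_ hr) H2.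
exact: clim_unique H2 H1.
Qed.

End PowerSeries.

(** * Complex derivatives *)

Section RealDerivative.
Context {R : realType}.
Implicit Types (g : R -> R) (x d : R).

(** Real derivatives in the same form as [hol], so that passing to the real part costs only
    [Re_le_cabs]. *)
Lemma is_derive_littleo g x d :
  is_derive x 1 g d <-> forall e : R, 0 < e -> exists2 D : R, 0 < D &
    forall h, `|h| < D -> `|g (x + h) - g x - d * h| <= e * `|h|.
Proof.
split=> [[dg <-] e e0|H].
  have /cvgrPdist_le/(_ _ e0) := dg.
  rewrite near_withinE => /nbhs_ballP[D /= D0 hD]; exists D => // h hh.
  have [->|h0] := eqVneq h 0; first by rewrite addr0 subrr mulr0 subrr normr0 mulr0.
  have := hD h; rewrite /ball /= sub0r normrN => /(_ hh h0).
  rewrite /GRing.scale /= mulr1 -/('D_1 g x) (addrC h) => hle.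
  have -> : g (x + h) - g x - 'D_1 g x * h =
      - (('D_1 g x - h^-1 * (g (x + h) - g x)) * h) by field.
  by rewrite normrN normrM ler_wpM2r.
have H' : h^-1 *: (g (h *: (1 : R) + x) - g x) @[h --> 0^'] --> d.
  apply/cvgrPdist_le => e e0; have [D D0 hD] := H _ e0.
  rewrite near_withinE; apply/nbhs_ballP; exists D => //= h.
  rewrite /ball /= sub0r normrN => hh h0.
  rewrite /GRing.scale /= mulr1 (addrC h).
  have h0' : 0 < `|h| by rewrite normr_gt0.
  rewrite distrC -(ler_pM2r h0') -normrM.
  have -> : (h^-1 * (g (x + h) - g x) - d) * h = g (x + h) - g x - d * h by field.
  exact: hD.
by split; [apply/cvg_ex; exists d|exact: cvg_lim H'].
Qed.

Lemma is_derive_mull g a x d : is_derive (a * x) 1 g d ->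
  is_derive x 1 (fun t => g (a * t)) (a * d).
Proof.
move=> /is_derive_littleo H; apply/is_derive_littleo => e e0.
have a1 : 0 < `|a| + 1 by rewrite ltr_wpDl.
have [D D0 hD] := H _ (divr_gt0 e0 a1).
exists (D / (`|a| + 1)); first by rewrite divr_gt0.
move=> h; rewrite ltr_pdivlMr// => hh; rewrite mulrDr (mulrC a d) -mulrA.
have ah : `|a * h| <= (`|a| + 1) * `|h| by rewrite normrM ler_wpM2r// lerDl.
apply: le_trans (hD _ _) _; first by apply: le_lt_trans ah _; rewrite mulrC.
apply: le_trans (ler_wpM2l _ ah) _; first exact/ltW/divr_gt0.
by rewrite mulrA divfK// gt_eqF.
Qed.

End RealDerivative.

(** * Rules for holomorphic functions and the complex exponential *)

Section Holomorphic.
Context {R : realType}.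
Implicit Types (f F G : R[i] -> R[i]) (z w h d u : R[i]).

Definition ccont f z : Prop := forall e : R, 0 < e ->
  exists2 D : R, 0 < D & forall h, cabs h < D -> cabs (f (z + h) - f z) <= e.

Lemma hol_lipschitz f z d : hol f z d -> exists2 D : R, 0 < D &
  forall h, cabs h < D -> cabs (f (z + h) - f z) <= (cabs d + 1) * cabs h.
Proof.
move=> /(_ 1 ltr01)[D D0 hD]; exists D => // h /hD hh.
have -> : f (z + h) - f z = (f (z + h) - f z - d * h) + d * h by ring.
by rewrite (le_trans (cabsD _ _))// mulrDl addrC cabsM; apply: lerD.
Qed.

Lemma hol_ccont f z d : hol f z d -> ccont f z.
Proof.
move=> /hol_lipschitz[D D0 hD] e e0.
have d1 : 0 < cabs d + 1 by rewrite ltr_wpDl ?cabs_ge0.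
exists (Num.min D (e / (cabs d + 1))); first by rewrite lt_min D0 divr_gt0.
move=> h; rewrite lt_min => /andP[/hD hh he]; apply: le_trans hh _.
by move: he; rewrite ltr_pdivlMr// mulrC => /ltW.
Qed.

Lemma hol_cst (c : R[i]) z : hol (fun=> c) z 0.
Proof.
move=> e e0; exists 1 => // h _.
by rewrite subrr mul0r subrr cabs0 mulr_ge0 ?cabs_ge0 ?ltW.
Qed.

Lemma holD F G z d d' : hol F z d -> hol G z d' ->
  hol (fun w => F w + G w) z (d + d').
Proof.
move=> hF hG e e0; have e2 : 0 < e / 2 by rewrite divr_gt0.
have [D D0 hD] := hF _ e2; have [D' D'0 hD'] := hG _ e2.
exists (Num.min D D'); first by rewrite lt_min D0.
move=> h; rewrite lt_min => /andP[/hD a /hD' b].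
have -> : F (z + h) + G (z + h) - (F z + G z) - (d + d') * h =
  (F (z + h) - F z - d * h) + (G (z + h) - G z - d' * h) by ring.
by rewrite (le_trans (cabsD _ _))//; apply: le_trans (lerD a b) _; lra.
Qed.

Lemma holM F G z d d' : hol F z d -> hol G z d' ->
  hol (fun w => F w * G w) z (d * G z + F z * d').
Proof.
move=> hF hG e e0.
have [D1 D10 h1] := hol_lipschitz hF; have [D2 D20 h2] := hol_lipschitz hG.
set A := cabs d + 1 in h1; set B := cabs d' + 1 in h2.
have A0 : 0 < A by rewrite ltr_wpDl ?cabs_ge0.
have B0 : 0 < B by rewrite ltr_wpDl ?cabs_ge0.
pose N := cabs (F z) + cabs (G z) + 1.
have N0 : 0 < N by rewrite ltr_wpDl// addr_ge0 ?cabs_ge0.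
have e1 : 0 < e / (2 * N) by rewrite divr_gt0// mulr_gt0.
have [D3 D30 h3] := hF _ e1; have [D4 D40 h4] := hG _ e1.
exists (Num.min (Num.min D1 D2) (Num.min (Num.min D3 D4) (e / (2 * (A * B))))).
  by rewrite !lt_min D10 D20 D30 D40 divr_gt0// !mulr_gt0.
move=> h; rewrite !lt_min.
move=> /andP[/andP[/h1 {}h1 /h2 {}h2] /andP[/andP[/h3 {}h3 /h4 {}h4] he]].
have -> : F (z + h) * G (z + h) - F z * G z - (d * G z + F z * d') * h =
  (F (z + h) - F z - d * h) * G z + F z * (G (z + h) - G z - d' * h) +
  (F (z + h) - F z) * (G (z + h) - G z) by ring.
have H1 : cabs ((F (z + h) - F z - d * h) * G z) <=
    e / (2 * N) * cabs h * cabs (G z).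
  by rewrite cabsM ler_wpM2r ?cabs_ge0.
have H2 : cabs (F z * (G (z + h) - G z - d' * h)) <=
    cabs (F z) * (e / (2 * N) * cabs h).
  by rewrite cabsM ler_wpM2l ?cabs_ge0.
have H3 : cabs ((F (z + h) - F z) * (G (z + h) - G z)) <= e / 2 * cabs h.
  rewrite cabsM; apply: le_trans (ler_pM (cabs_ge0 _) (cabs_ge0 _) h1 h2) _.
  have -> : A * cabs h * (B * cabs h) = A * B * cabs h * cabs h by ring.
  apply: ler_wpM2r; first exact: cabs_ge0.
  move: he; rewrite ltr_pdivlMr ?mulr_gt0// => he.
  by rewrite ler_pdivlMr// mulrC mulrA mulrC ltW.
apply: le_trans (cabsD _ _) _.
apply: le_trans (lerD (le_trans (cabsD _ _) (lerD H1 H2)) H3) _.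
have -> : e / (2 * N) * cabs h * cabs (G z) + cabs (F z) * (e / (2 * N) * cabs h)
   = e / (2 * N) * (N - 1) * cabs h by rewrite /N; ring.
rewrite -mulrDl; apply: ler_wpM2r; first exact: cabs_ge0.
have -> : e / (2 * N) * (N - 1) = e / 2 - e / (2 * N).
  by field; exact: lt0r_neq0.
by lra.
Qed.

Lemma holZ c F z d : hol F z d -> hol (fun w => c * F w) z (c * d).
Proof. by move=> /(holM (hol_cst c z)); rewrite mul0r add0r. Qed.

Lemma holB F G z d d' : hol F z d -> hol G z d' ->
  hol (fun w => F w - G w) z (d - d').
Proof.
move=> hF /(holZ (-1)); rewrite mulN1r => /(holD hF).
by congr hol; apply/funext => w; rewrite mulN1r.
Qed.

Lemma holV F z d : hol F z d -> F z != 0 ->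
  hol (fun w => (F w)^-1) z (- d * ((F z)^-1 * (F z)^-1)).
Proof.
move=> hF Fz0 e e0; set c := F z in Fz0 *.
have c0 : 0 < cabs c by rewrite cabs_gt0.
have [D1 D10 h1] := hol_lipschitz hF; set A := cabs d + 1 in h1.
have A0 : 0 < A by rewrite ltr_wpDl ?cabs_ge0.
have e1 : 0 < e * cabs c ^+ 2 / 4 by rewrite !mulr_gt0// exprn_gt0.
have [D2 D20 h2] := hF _ e1.
(* The third bound keeps [|F (z + h)|] above [|F z| / 2]; the fourth controls the product of [d h]
   with the increment of [F]. *)
exists (Num.min (Num.min D1 D2)
   (Num.min (cabs c / (2 * A)) (e * cabs c ^+ 3 / (4 * A ^+ 2)))).
  by rewrite !lt_min D10 D20 !divr_gt0 ?mulr_gt0 ?exprn_gt0.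
move=> h; rewrite !lt_min => /andP[/andP[/h1 {}h1 /h2 {}h2] /andP[hc he]].
have Fh : cabs c / 2 <= cabs (F (z + h)).
  move: hc; rewrite ltr_pdivlMr ?mulr_gt0// => hc.
  have -> : F (z + h) = c + (F (z + h) - c) by ring.
  have := cabs_lerB c (- (F (z + h) - c)).
  by rewrite opprK cabsN; move: h1; rewrite -/c => h1 ?; lra.
have Fh0 : 0 < cabs (F (z + h)) by apply: lt_le_trans Fh; rewrite divr_gt0.
have -> : (F (z + h))^-1 - c^-1 - - d * (c^-1 * c^-1) * h =
  (- c * (F (z + h) - c - d * h) + d * h * (F (z + h) - c)) / (F (z + h) * c ^+ 2).
  by field; rewrite Fz0 -cabs_eq0 gt_eqF.
rewrite cabsM cabsV cabsM cabsX ler_pdivrMr; last by rewrite mulr_gt0// exprn_gt0.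
apply: le_trans (cabsD _ _) _; rewrite !cabsM cabsN.
have H1 : cabs c * cabs (F (z + h) - c - d * h) <=
    cabs c * (e * cabs c ^+ 2 / 4 * cabs h).
  by apply: ler_wpM2l => //; exact: ltW.
have H2 : cabs d * cabs h * cabs (F (z + h) - c) <= e * cabs c ^+ 3 / 4 * cabs h.
  apply: (@le_trans _ _ (A * cabs h * (A * cabs h))).
    apply: ler_pM; rewrite ?mulr_ge0 ?cabs_ge0//.
    by apply: ler_wpM2r; rewrite ?cabs_ge0// lerDl.
  rewrite mulrA; apply: ler_wpM2r; first exact: cabs_ge0.
  move: he; rewrite ltr_pdivlMr ?mulr_gt0 ?exprn_gt0// => he.
  by rewrite ler_pdivlMr//; apply: ltW; move: he; congr (_ < _); ring.
apply: le_trans (lerD H1 H2) _.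
have -> : cabs c * (e * cabs c ^+ 2 / 4 * cabs h) + e * cabs c ^+ 3 / 4 * cabs h =
  e * cabs h * (cabs c / 2 * cabs c ^+ 2) by field.
apply: ler_wpM2l; first by rewrite mulr_ge0 ?cabs_ge0// ltW.
by apply: ler_wpM2r => //; exact/exprn_ge0/ltW.
Qed.

(** This is [e^(i a z)], written with real functions. *)
Definition cexpi (a : R) z : R[i] :=
  (expR (- (a * complex.Im z)))%:C * cis (a * complex.Re z).

Lemma cisD (s t : R) : cis (s + t) = cis s * cis t.
Proof. by rewrite /cis cosD sinD; simpc; rewrite [X in _ +i* X]addrC. Qed.

Lemma cis0 : cis (0 : R) = 1.
Proof. by rewrite /cis cos0 sin0. Qed.

Lemma cabs_cis (t : R) : cabs (cis t) = 1.
Proof. by rewrite /cabs /cis /= cos2Dsin2 sqrtr1. Qed.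

Lemma cabs_cexpi a z : cabs (cexpi a z) = expR (- (a * complex.Im z)).
Proof. by rewrite /cexpi cabsM cabs_cis mulr1 cabsR gtr0_norm// expR_gt0. Qed.

Lemma cexpiD a z w : cexpi a (z + w) = cexpi a z * cexpi a w.
Proof.
rewrite /cexpi ReD ImD !mulrDr cisD opprD expRD rmorphM /=; ring.
Qed.

Lemma cexpi_addl a b z : cexpi (a + b) z = cexpi a z * cexpi b z.
Proof.
by rewrite /cexpi !mulrDl cisD opprD expRD rmorphM /=; ring.
Qed.

Lemma cexpi_real a (x : R) : cexpi a x%:C = cis (a * x).
Proof. by rewrite /cexpi /= mulr0 oppr0 expR0 mul1r. Qed.

Lemma cexpi0 a : cexpi a 0 = 1.
Proof. by rewrite -[0]/((0:R)%:C) cexpi_real mulr0 cis0. Qed.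

(** [C], [S] and [P] stand for [cos (a x)], [sin (a x)] and [e^(- a y)]. The right side consists of
    first-order remainders of these three functions at 0, in the shape produced by
    [is_derive_littleo], and of one product of two small factors. *)
Lemma cexp_expansion (a x y C S P : R) :
  P%:C * (C +i* S) - 1 - 'i%C * a%:C * (x +i* y) =
  ((C - 1 - 0 * x)%:C + 'i%C * (S - 0 - a * x)%:C) +
  (P - 1)%:C * ((C - 1 - 0 * x)%:C + 'i%C * S%:C) + (P - 1 - - a * y)%:C.
Proof.
rewrite [C +i* S]complexE [x +i* y]complexE /= mul0r !subr0 mulNr opprK.
rewrite !(rmorphB, rmorphD, rmorphM) /= rmorph1.
have -> : 'i%C * a%:C * (x%:C + 'i%C * y%:C) =
   'i%C * a%:C * x%:C + ('i%C ^+ 2) * (a%:C * y%:C) by ring.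
by rewrite sqr_i; ring.
Qed.

Lemma hol_cexpi0 a : hol (cexpi a) 0 ('i%C * a%:C).
Proof.
have /is_derive_littleo dc := @is_derive_mull _ cos a 0 _ (is_derive_cos _).
have /is_derive_littleo ds := @is_derive_mull _ sin a 0 _ (is_derive_sin _).
have /is_derive_littleo de := @is_derive_mull _ expR (- a) 0 _ (is_derive_expR _).
move: dc ds de; rewrite !mulr0 expR0 sin0 cos0 oppr0 mulr0 !mulr1 => dc ds de e e0.
pose A := `|a| + 1; have A0 : 0 < A by rewrite ltr_wpDl.
have e8 : 0 < e / 8 by rewrite divr_gt0.
have [D1 D10 h1] := dc _ e8; have [D2 D20 h2] := ds _ e8.
have [D3 D30 h3] := de _ e8; have [D4 D40 h4] := de _ ltr01.
(* The product in [cexp_expansion] is at most [2 A^2 r^2], with [r] the modulus of the increment, so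
   [r < E] brings it below [e r / 4]. *)
pose E := e / (8 * A ^+ 2).
have E0 : 0 < E by rewrite divr_gt0// mulr_gt0// exprn_gt0.
have [D5 D50 h5] := dc _ ltr01; have [D6 D60 h6] := ds _ ltr01.
pose D := Num.min (Num.min (Num.min D1 D2) (Num.min D3 D4)) (Num.min (Num.min D5 D6) E).
exists D; first by rewrite !lt_min D10 D20 D30 D40 D50 D60 E0.
move=> h hD; rewrite add0r cexpi0.
case: h hD => x y hD.
have [xh yh] : `|x| <= cabs (x +i* y) /\ `|y| <= cabs (x +i* y).
  by split; [exact: (Re_le_cabs (x +i* y))|exact: (Im_le_cabs (x +i* y))].
set r := cabs (x +i* y) in hD xh yh *.
move: (le_lt_trans xh hD); rewrite /D !lt_min.
move=> /andP[/andP[/andP[/h1 {}h1 /h2 {}h2] _] /andP[/andP[/h5 {}h5 /h6 {}h6] _]].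
move: (le_lt_trans yh hD); rewrite /D !lt_min.
move=> /andP[/andP[_ /andP[/h3 {}h3 /h4 {}h4]] _].
have rE : r < E by move: hD; rewrite /D !lt_min => /andP[_ /andP[]].
rewrite !add0r in h1 h5 h3 h4; rewrite !add0r !addr0 -[sin _]subr0 in h2 h6.
clear D hD.
set c1 := cos (a * x) - 1 - 0 * x in h1 h5.
set s1 := sin (a * x) - 0 - a * x in h2 h6.
set p1 := expR (- a * y) - 1 - - a * y in h3 h4.
have -> : cexpi a (x +i* y) - 1 - 'i%C * a%:C * (x +i* y) =
  (c1%:C + 'i%C * s1%:C) + (expR (- a * y) - 1)%:C * (c1%:C + 'i%C * (sin (a * x))%:C)
  + p1%:C.
  rewrite /cexpi /= -[- (a * y)]mulNr /c1 /s1 /p1; exact: cexp_expansion.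
have r0 : 0 <= r := cabs_ge0 _.
have Hp : `|expR (- a * y) - 1| <= A * r.
  have -> : expR (- a * y) - 1 = p1 + - a * y by rewrite /p1; ring.
  apply: le_trans (ler_normD _ _) _; rewrite normrM normrN.
  apply: (@le_trans _ _ (1 * `|y| + `|a| * `|y|)); first by rewrite lerD2r.
  by rewrite -mulrDl addrC; apply: ler_wpM2l => //; exact: (ltW A0).
have Hs : `|sin (a * x)| <= A * r.
  have -> : sin (a * x) = s1 + a * x by rewrite /s1; ring.
  apply: le_trans (ler_normD _ _) _; rewrite normrM.
  apply: (@le_trans _ _ (1 * `|x| + `|a| * `|x|)); first by rewrite lerD2r.
  by rewrite -mulrDl addrC; apply: ler_wpM2l => //; exact: (ltW A0).
have Hc : `|c1| <= A * r.
  apply: (le_trans h5); apply: ler_pM => //.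
  by rewrite /A lerDr.
have B1 : cabs (c1%:C + 'i%C * s1%:C) <= e / 8 * r + e / 8 * r.
  apply: le_trans (cabsD _ _) _; rewrite cabsM cabs_i mul1r !cabsR.
  by apply: lerD; [apply: (le_trans h1)|apply: (le_trans h2)];
     apply: ler_wpM2l => //; exact: ltW.
have B2 : cabs (c1%:C + 'i%C * (sin (a * x))%:C) <= A * r + A * r.
  apply: le_trans (cabsD _ _) _; rewrite cabsM cabs_i mul1r !cabsR.
  exact: lerD.
have B3 : cabs ((expR (- a * y) - 1)%:C * (c1%:C + 'i%C * (sin (a * x))%:C)) <=
    e / 4 * r.
  rewrite cabsM cabsR; apply: le_trans (ler_pM _ _ Hp B2) _ => //.
    exact: cabs_ge0.
  have -> : A * r * (A * r + A * r) = 2 * A ^+ 2 * r * r by ring.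
  apply: ler_wpM2r => //.
  move: rE; rewrite /E ltr_pdivlMr; last by rewrite mulr_gt0// exprn_gt0.
  by move=> rE; nra.
have B4 : cabs (p1%:C : R[i]) <= e / 8 * r.
  rewrite cabsR; apply: (le_trans h3); apply: ler_wpM2l => //; exact: ltW.
apply: le_trans (cabsD _ _) _.
apply: le_trans (lerD (le_trans (cabsD _ _) (lerD B1 B3)) B4) _.
have : 0 <= e * r by rewrite mulr_ge0// ltW.
by lra.
Qed.

Lemma hol_cexpi a z : hol (cexpi a) z ('i%C * a%:C * cexpi a z).
Proof.
move=> e e0; have c0 : 0 < cabs (cexpi a z) by rewrite cabs_cexpi expR_gt0.
have [D D0 hD] := @hol_cexpi0 a _ (divr_gt0 e0 c0).
exists D => // h /hD; rewrite add0r cexpi0 => hh.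
have -> : cexpi a (z + h) - cexpi a z - 'i%C * a%:C * cexpi a z * h =
  cexpi a z * (cexpi a h - 1 - 'i%C * a%:C * h) by rewrite cexpiD; ring.
rewrite cabsM; apply: le_trans (ler_wpM2l (cabs_ge0 _) hh) _.
by rewrite mulrA [_ * (e / _)]mulrC divfK// gt_eqF.
Qed.

Lemma is_derive_hol_Re f z d v (t : R) : hol f (z + t%:C * v) d ->
  is_derive t 1 (fun s => complex.Re (f (z + s%:C * v))) (complex.Re (d * v)).
Proof.
move=> H; apply/is_derive_littleo => e e0.
have v1 : 0 < cabs v + 1 by rewrite ltr_wpDl ?cabs_ge0.
have [D D0 hD] := H _ (divr_gt0 e0 v1).
exists (D / (cabs v + 1)); first by rewrite divr_gt0.
move=> h; rewrite ltr_pdivlMr// => hh.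
have hv : cabs (h%:C * v) <= `|h| * (cabs v + 1).
  by rewrite cabsM cabsR ler_wpM2l// lerDl.
have := hD (h%:C * v) (le_lt_trans hv hh).
have -> : z + t%:C * v + h%:C * v = z + (t + h)%:C * v by rewrite rmorphD /=; ring.
move=> hle.
have -> : complex.Re (f (z + (t + h)%:C * v)) - complex.Re (f (z + t%:C * v)) -
  complex.Re (d * v) * h = complex.Re (f (z + (t + h)%:C * v) - f (z + t%:C * v) -
   d * (h%:C * v)).
  by rewrite !ReB; congr (_ - _); rewrite mulrCA ReZ mulrC.
apply: le_trans (Re_le_cabs _) _; apply: le_trans hle _.
apply: le_trans (ler_wpM2l _ hv) _; first exact/ltW/divr_gt0.
by rewrite mulrCA divfK ?gt_eqF// mulrC.
Qed.

Lemma ccont_continuous_Re f z v (t : R) : ccont f (z + t%:C * v) ->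
  {for t, continuous (fun s : R => complex.Re (f (z + s%:C * v)) : R)}.
Proof.
move=> H; apply/cvgrPdist_le => e e0; have [D D0 hD] := H _ e0.
have v1 : 0 < cabs v + 1 by rewrite ltr_wpDl ?cabs_ge0.
apply/nbhs_ballP; exists (D / (cabs v + 1)); first by rewrite /= divr_gt0.
move=> s; rewrite /ball /= distrC ltr_pdivlMr// => hs.
rewrite distrC -ReB; apply: le_trans (Re_le_cabs _) _.
have -> : z + s%:C * v = z + t%:C * v + (s - t)%:C * v by rewrite rmorphB /=; ring.
apply: hD; apply: le_lt_trans hs; rewrite cabsM cabsR ler_wpM2l// lerDl.
by [].
Qed.

End Holomorphic.

(** * Shifting horizontal contours *)

Section Contours.
Context {R : realType}.
Implicit Types (f F G H : R[i] -> R[i]) (z w h d u : R[i]).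
Local Notation mu := (@lebesgue_measure R).

(** Compactness of the rectangle. Local upper bounds are asked for instead of continuity because one
    application is to a kernel with a bounded singularity. *)
Lemma rect_bounded (g : R[i] -> R) (a b c d : R) :
  (forall z, a <= complex.Re z <= b -> c <= complex.Im z <= d ->
    exists K D : R, 0 < D /\ forall h, cabs h < D -> g (z + h) <= K) ->
  exists K : R, forall z, a <= complex.Re z <= b -> c <= complex.Im z <= d ->
    g z <= K.
Proof.
move=> loc.
have cpt : compact (`[a, b] `*` `[c, d] : set (R * R)%type).
  by apply: compact_setX; exact: segment_compact.
move/compact_near_coveringP : cpt.
move=> /(_ R (pinfty_nbhs R) (fun M p => g (p.1 +i* p.2) <= M) _) [].
  move=> [x y] [/=]; rewrite !in_itv /= => xab ycd.
  have [K [D [D0 hD]]] := loc (x +i* y) xab ycd.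
  exists (ball (x, y) (D / 2), [set M | K <= M]) => /=.
    split; first by apply: nbhsx_ballx; rewrite divr_gt0.
    by apply: nbhs_pinfty_ge; rewrite num_real.
  move=> [[x' y'] M] [[/= bx by_] KM] /=; apply: le_trans KM.
  have -> : x' +i* y' = x +i* y + ((x' - x) +i* (y' - y)).
    by simpc; rewrite !subrKC.
  apply: hD; apply: le_lt_trans (cabs_le _) _ => /=.
  rewrite (splitr D); apply: ltrD; rewrite distrC; [exact: bx|exact: by_].
move=> M [_ hM]; exists (M + 1) => z zab zcd.
have : M < M + 1 by rewrite ltrDl.
move=> /hM /(_ (complex.Re z, complex.Im z)) /=; rewrite !in_itv /=.
by case: z zab zcd => x y /= xab ycd; apply.
Qed.

Lemma continuous_integrable (g : R -> R) (a b : R) :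
  (forall x, a <= x <= b -> {for x, continuous g}) ->
  mu.-integrable `[a, b] (EFin \o g).
Proof.
move=> cg; apply: continuous_compact_integrable; first exact: segment_compact.
by apply: continuous_in_subspaceT => x; rewrite inE /= in_itv /=; exact: cg.
Qed.

Lemma is_derive_continuous (g : R -> R) (x d : R) : is_derive x 1 g d ->
  {for x, continuous g}.
Proof.
by move=> dg; apply/differentiable_continuous/derivable1_diffP; exact: ex_derive.
Qed.

Lemma is_derive_LRcontinuous (g dg : R -> R) (a b : R) : a < b ->
  (forall x, a <= x <= b -> is_derive x 1 g (dg x)) ->
  derivable_oo_LRcontinuous g a b /\ {in `]a, b[, derive1 g =1 dg}.
Proof.
move=> ab Dg; have gc x : a <= x <= b -> {for x, continuous g}.
  by move=> /Dg; exact: is_derive_continuous.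
have oo x : x \in `]a, b[ -> is_derive x 1 g (dg x).
  by rewrite in_itv /= => /andP[/ltW ax /ltW xb]; apply: Dg; rewrite ax.
split; last by move=> x /oo h; rewrite derive1E; exact: derive_val.
split.
- by move=> x /oo h; exact: ex_derive.
- by apply: cvg_at_right_filter; apply: gc; rewrite lexx ltW.
- by apply: cvg_at_left_filter; apply: gc; rewrite lexx ltW.
Qed.

Lemma Rintegral_FTC (g dg : R -> R) (a b : R) : a < b ->
  (forall x, a <= x <= b -> is_derive x 1 g (dg x)) ->
  (forall x, a <= x <= b -> {for x, continuous dg}) ->
  \int[mu]_(x in `[a, b]) dg x = g b - g a.
Proof.
move=> ab Dg cdg; have [g1 g2] := is_derive_LRcontinuous ab Dg.
rewrite /Rintegral (@continuous_FTC2 _ dg g)//.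
by apply: continuous_in_subspaceT => x; rewrite inE /= in_itv /=; exact: cdg.
Qed.

Lemma horizontal_line (x y : R) : x +i* y = (0 +i* y) + x%:C * 1.
Proof. by rewrite mulr1; simpc. Qed.

Lemma vertical_line (x y : R) : x +i* y = (x +i* 0) + y%:C * 'i%C.
Proof. by simpc. Qed.

Lemma hol_Re_horizontal f (x y : R) d : hol f (x +i* y) d ->
  is_derive x 1 (fun t : R => complex.Re (f (t +i* y)) : R) (complex.Re d).
Proof.
rewrite [x +i* y]horizontal_line => /is_derive_hol_Re; rewrite mulr1.
by rewrite (_ : (fun s => _) = fun t : R => complex.Re (f (t +i* y)))//;
  apply/funext => t; rewrite -horizontal_line.
Qed.

Lemma hol_Re_vertical f (x y : R) d : hol f (x +i* y) d ->
  is_derive y 1 (fun t : R => complex.Re (f (x +i* t)) : R) (complex.Re (d * 'i%C)).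
Proof.
rewrite [x +i* y]vertical_line => /is_derive_hol_Re.
by rewrite (_ : (fun s => _) = fun t : R => complex.Re (f (x +i* t)))//;
  apply/funext => t; rewrite -vertical_line.
Qed.

Lemma ccont_Re_horizontal f (x y : R) : ccont f (x +i* y) ->
  {for x, continuous (fun t : R => complex.Re (f (t +i* y)) : R)}.
Proof.
rewrite [x +i* y]horizontal_line => /ccont_continuous_Re.
by rewrite /prop_for (_ : (fun s => _) = fun t : R => complex.Re (f (t +i* y)))//;
  apply/funext => t; rewrite -horizontal_line.
Qed.

Lemma ccont_Re_vertical f (x y : R) : ccont f (x +i* y) ->
  {for y, continuous (fun t : R => complex.Re (f (x +i* t)) : R)}.
Proof.
rewrite [x +i* y]vertical_line => /ccont_continuous_Re.
by rewrite /prop_for (_ : (fun s => _) = fun t : R => complex.Re (f (x +i* t)))//;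
  apply/funext => t; rewrite -vertical_line.
Qed.

Lemma ccontZ c f z : ccont f z -> ccont (fun w => c * f w) z.
Proof.
move=> cf e e0; have c1 : 0 < cabs c + 1 by rewrite ltr_wpDl ?cabs_ge0.
have [D D0 hD] := cf _ (divr_gt0 e0 c1); exists D => // h /hD.
rewrite -mulrBr cabsM ler_pdivlMr// => hh; apply: le_trans hh.
by rewrite mulrC ler_wpM2l ?cabs_ge0// lerDl.
Qed.

Lemma is_derive_zero_eq (F : R -> R) (y1 y2 : R) :
  (forall y, y1 < y < y2 -> is_derive y 1 F 0) ->
  forall y y', y1 < y < y2 -> y1 < y' < y2 -> F y = F y'.
Proof.
move=> dF; suff H y y' : y1 < y < y2 -> y1 < y' < y2 -> y < y' -> F y = F y'.
  move=> y y' hy hy'; have [yy'|yy'|->//] := ltgtP y y'; first exact: H.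
  by apply/esym/H.
move=> /andP[a b] /andP[c d] yy'.
have I x : y <= x <= y' -> y1 < x < y2.
  by move=> /andP[p q]; rewrite (lt_le_trans a p) (le_lt_trans q d).
have [||t _] := @MVT R F (fun=> 0) y y' yy'.
- move=> t; rewrite in_itv /= => /andP[/ltW p /ltW q].
  by apply: dF; apply: I; rewrite p q.
- apply: continuous_in_subspaceT => t; rewrite inE /= in_itv /= => /I /dF.
  exact: is_derive_continuous.
- by rewrite mul0r => /eqP; rewrite subr_eq0 => /eqP.
Qed.

(** The derivative of the integral in [y] is the integral of [Re (i H')], that is, the increment of
    [Re (i H)] from [0 + i y] to [T + i y], which is 0 by periodicity. *)
Lemma Re_integral_line_const H H' (T y1 y2 : R) : 0 < T ->
  (forall z, 0 <= complex.Re z <= T -> y1 < complex.Im z < y2 ->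
     hol H z (H' z) /\ ccont H' z) ->
  (forall y, y1 < y < y2 -> H (0 +i* y) = H (T +i* y)) ->
  forall y y', y1 < y < y2 -> y1 < y' < y2 ->
  \int[mu]_(t in `[0, T]) complex.Re (H (t +i* y)) =
  \int[mu]_(t in `[0, T]) complex.Re (H (t +i* y')).
Proof.
move=> T0 hH per; apply: is_derive_zero_eq => y0 /andP[y10 y02].
(* [H'] may be unbounded on the open band. On the closed band between [u] and [v] it is bounded,
   which gives a constant dominating function. *)
pose u := (y1 + y0) / 2; pose v := (y0 + y2) / 2.
have I : u < y0 < v by rewrite /u /v; apply/andP; split; lra.
have uv y : u <= y <= v -> y1 < y < y2.
  by rewrite /u /v => /andP[p q]; apply/andP; split; lra.
have [M hM] : exists M : R, forall z, 0 <= complex.Re z <= T ->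
    u <= complex.Im z <= v -> cabs (H' z) <= M.
  apply: rect_bounded => z z1 /uv z2; have [_ cH'] := hH z z1 z2.
  have [D D0 hD] := cH' 1 ltr01; exists (cabs (H' z) + 1), D; split => // h /hD.
  by have := cabs_lerB (H' (z + h)) (H' z); lra.
have dHy t y : 0 <= t <= T -> y1 < y < y2 ->
    is_derive y 1 (fun y : R => complex.Re (H (t +i* y)) : R)
      (complex.Re (H' (t +i* y) * 'i%C)).
  by move=> tT yy; apply: hol_Re_vertical; have [] := hH (t +i* y) tT yy.
have dHx t y : 0 <= t <= T -> y1 < y < y2 ->
    is_derive t 1 (fun t : R => complex.Re ('i%C * H (t +i* y)) : R)
      (complex.Re ('i%C * H' (t +i* y))).
  move=> tT yy; have [/(holZ 'i%C) hh _] := hH (t +i* y) tT yy.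
  exact: hol_Re_horizontal hh.
have cHx t y : 0 <= t <= T -> y1 < y < y2 ->
    {for t, continuous (fun t : R => complex.Re (H (t +i* y)) : R)}.
  move=> tT yy; have [/hol_ccont hh _] := hH (t +i* y) tT yy.
  exact: ccont_Re_horizontal.
have cHx' t y : 0 <= t <= T -> y1 < y < y2 ->
    {for t, continuous (fun t : R => complex.Re ('i%C * H' (t +i* y)) : R)}.
  move=> tT yy; have [_ /(ccontZ 'i%C) hh] := hH (t +i* y) tT yy.
  exact: (@ccont_Re_horizontal (fun z => 'i%C * H' z)).
pose f y t := complex.Re (H (t +i* y)).
have Iy0 : [set` `]u, v[] y0 by rewrite /= in_itv.
have inI y : [set` `]u, v[] y -> y1 < y < y2.
  by rewrite /= in_itv /= => /andP[/ltW p /ltW q]; apply: uv; rewrite p q.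
have d1E y t : [set` `]u, v[] y -> [set` `[0, T]] t ->
    partial1of2 f y t = complex.Re (H' (t +i* y) * 'i%C).
  move=> yI; rewrite /= in_itv /= => tT.
  by rewrite partial1of2E; have h := dHy t y tT (inI y yI); exact: derive_val.
have intf y : [set` `]u, v[] y -> mu.-integrable `[0, T] (EFin \o f y).
  by move=> /inI yI; apply: continuous_integrable => t tT; exact: cHx.
have derf y t : [set` `]u, v[] y -> [set` `[0, T]] t -> derivable (f ^~ t) y 1.
  move=> /inI yI; rewrite /= in_itv /= => tT.
  by have h := dHy t y tT yI; exact: ex_derive.
have M0 : 0 <= M.
  apply: le_trans (hM (0 +i* y0) _ _) => /=; first exact: cabs_ge0.
    by rewrite lexx ltW.
  by case/andP: I => /ltW p /ltW q; rewrite p q.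
have intM : mu.-integrable `[0, T] (EFin \o (fun _ : R => M)).
  by apply: continuous_integrable => t _; exact: cvg_cst.
have ub y t : [set` `]u, v[] y -> [set` `[0, T]] t -> `|partial1of2 f y t| <= M.
  move=> yI tT; rewrite d1E//; apply: le_trans (Re_le_cabs _) _.
  rewrite cabsM cabs_i mulr1; apply: hM => /=.
    by move: tT; rewrite /= in_itv.
  by move: yI; rewrite /= in_itv /= => /andP[/ltW -> /ltW ->].
have mI : measurable [set` `[0, T] : interval R] by exact: measurable_itv.
have := @differentiation_under_integral R _ _ mu f _ mI y0 u v Iy0 intf derf
   (fun=> M) (fun=> M0) intM ub.
have := @derivable_under_integral R _ _ mu f _ mI y0 u v Iy0 intf derf
   (fun=> M) (fun=> M0) intM ub.
set F := (fun x' => _); move=> dF F'.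
apply: DeriveDef => //; rewrite -derive1E F'.
have yy0 := inI y0 Iy0.
transitivity (\int[mu]_(t in `[0, T]) complex.Re ('i%C * H' (t +i* y0))).
  by apply: eq_Rintegral => t; rewrite inE => tT; rewrite d1E// mulrC.
have -> := @Rintegral_FTC (fun t => complex.Re ('i%C * H (t +i* y0)))
  (fun t => complex.Re ('i%C * H' (t +i* y0))) 0 T T0 (fun t tT => dHx t y0 tT yy0)
  (fun t tT => cHx' t y0 tT yy0).
by rewrite per// subrr.
Qed.

End Contours.

(** * Contours crossing one bounded singularity *)

Section SingularContours.
Context {R : realType}.
Implicit Types (f F G H : R[i] -> R[i]) (z w h d u : R[i]).
Local Notation mu := (@lebesgue_measure R).

Lemma itv_finite_measure (a b : R) : (mu `[a, b] < +oo)%E.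
Proof. by rewrite lebesgue_measure_itv /=; case: ifPn => // _; rewrite -EFinB ltry. Qed.

(** Measurability is checked on [[a, b]] without [x0], where [g] is continuous, and on [x0]
    alone. *)
Lemma bounded_continuous_off_integrable (g : R -> R) (a b x0 M : R) :
  (forall x, a <= x <= b -> x != x0 -> {for x, continuous g}) ->
  (forall x, a <= x <= b -> `|g x| <= M) ->
  mu.-integrable `[a, b] (EFin \o g).
Proof.
move=> cg gM.
have mab : measurable (`[a, b]%classic : set R) by exact: measurable_itv.
apply: measurable_bounded_integrable => //.
- exact: itv_finite_measure.
- have m1 : measurable [set x0] by exact: measurable_set1.
  have -> : `[a, b]%classic = (`[a, b] `\` [set x0]) `|` (`[a, b] `&` [set x0]).
    by rewrite setUC -setIUr setUv setIT.
  apply/measurable_funU; [exact: measurableD|exact: measurableI|split].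
    apply: subspace_continuous_measurable_fun; first exact: measurableD.
    apply: continuous_in_subspaceT => x; rewrite inE /= in_itv /= => -[xab /eqP].
    exact: cg.
  by apply: (measurable_funS m1); [exact: subIsetr|exact: measurable_fun_set1].
- exists M; split; rewrite ?num_real// => M' MM' x; rewrite /= in_itv /= => xab.
  by apply: le_trans (gM x xab) _; exact: ltW.
Qed.

(* The integral is constant on either side of the singular line, and continuous
   across it by dominated convergence. *)
Lemma Re_integral_cross H H' (T b x0 M : R) : 0 < T -> 0 < b ->
  (forall z, 0 <= complex.Re z <= T -> - b < complex.Im z < b -> z != x0%:C ->
     hol H z (H' z) /\ ccont H' z) ->
  (forall z, 0 <= complex.Re z <= T -> - b < complex.Im z < b -> cabs (H z) <= M) ->
  (forall y, - b < y < b -> H (0 +i* y) = H (T +i* y)) ->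
  forall y, - b < y < b ->
  \int[mu]_(t in `[0, T]) complex.Re (H (t +i* y)) =
  \int[mu]_(t in `[0, T]) complex.Re (H (t +i* 0)).
Proof.
move=> T0 b0 hH HM per y yb.
pose f y t := complex.Re (H (t +i* y)).
pose F y : R := \int[mu]_(t in `[0, T]) f y t.
rewrite -/(F y) -/(F 0).
have offx t s : t != x0 -> t +i* s != x0%:C.
  by apply: contra => /eqP[-> _].
have inI s : [set` `]- b, b[] s -> - b < s < b by rewrite /= in_itv.
have intf s : [set` `]- b, b[] s -> mu.-integrable `[0, T] (EFin \o f s).
  move=> /inI sb; apply: (@bounded_continuous_off_integrable _ _ _ x0 M).
    move=> x xT xx0; have [/hol_ccont hh _] := hH (x +i* s) xT sb (offx _ _ xx0).
    exact: ccont_Re_horizontal.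
  by move=> x xT; apply: le_trans (Re_le_cabs _) _; exact: HM.
have intM : mu.-integrable `[0, T] (EFin \o (fun _ : R => M)).
  by apply: continuous_integrable => t _; exact: cvg_cst.
have cf : {ae mu, forall t, [set` `[0, T]] t ->
    {in [set` `]- b, b[], continuous (f ^~ t)}}.
  exists [set x0]; split; [exact: measurable_set1|exact: lebesgue_measure_set1|].
  move=> t /= nt; apply: contrapT => /eqP tx0; apply: nt.
  rewrite in_itv /= => tT s; rewrite inE => /inI sb.
  have [/hol_ccont hh _] := hH (t +i* s) tT sb (offx _ _ tx0).
  exact: ccont_Re_vertical.
have ub s : [set` `]- b, b[] s ->
    {ae mu, forall t, [set` `[0, T]] t -> `|f s t| <= M}.
  move=> /inI sb; apply/aeW => t; rewrite /= in_itv /= => tT.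
  by apply: le_trans (Re_le_cabs _) _; exact: HM.
have mI : measurable [set` `[0, T] : interval R] by exact: measurable_itv.
have cF := @continuity_under_integral R _ _ mu f _ mI (- b) b intf cf
   (fun=> M) intM ub.
have {cF} /cvgrPdist_le cF : {for 0, continuous F}.
  by apply: cF; rewrite inE /= in_itv /= oppr_lt0 b0.
(* The condition [0 < s * y] says that [s] and [y] lie on the same side of the singular line. *)
have side s : 0 < s * y -> - b < s < b -> F s = F y.
  move=> sy sb; rewrite /F /f.
  have [s0|s0] : 0 < s \/ s < 0.
    by case: (ltgtP 0 s) sy => [||<-]; rewrite ?mul0r ?ltxx; auto.
  - have y0 : 0 < y by move: sy; rewrite pmulr_rgt0.
    apply: (@Re_integral_line_const R H H' T 0 b T0).
    + move=> z zT /andP[z0 zb]; apply: hH => //; first by rewrite zb andbT; lra.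
      by apply: contraTneq z0 => ->; rewrite ltxx.
    + by move=> u /andP[u0 ub']; apply: per; rewrite ub' andbT; lra.
    + by rewrite s0; case/andP: sb.
    + by rewrite y0; case/andP: yb.
  - have y0 : y < 0 by move: sy; rewrite nmulr_rgt0.
    apply: (@Re_integral_line_const R H H' T (- b) 0 T0).
    + move=> z zT /andP[zb z0]; apply: hH => //; first by rewrite zb; lra.
      by apply: contraTneq z0 => ->; rewrite ltxx.
    + by move=> u /andP[ub' u0]; apply: per; rewrite ub'; lra.
    + by rewrite s0 andbT; case/andP: sb.
    + by rewrite y0 andbT; case/andP: yb.
have [->//|y0] := eqVneq y 0.
apply/esym/eqP; rewrite -subr_eq0 -normr_eq0 eq_le normr_ge0 andbT.
apply/ler_addgt0Pr => e e0; rewrite add0r.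
have /nbhs_ballP[D /= D0 hD] := cF _ e0.
(* [k y] lies on the same side as [y], within [D] of the singular line. *)
pose k := Num.min 1 (D / (2 * `|y|)).
have ay : 0 < `|y| by rewrite normr_gt0.
have k0 : 0 < k by rewrite lt_min ltr01 divr_gt0// mulr_gt0.
have k1 : k <= 1 by rewrite ge_min lexx.
have kD : k <= D / (2 * `|y|) by rewrite ge_min lexx orbT.
rewrite -(side (k * y)).
- apply: hD; rewrite /ball /= sub0r normrN normrM gtr0_norm//.
  move: kD; rewrite ler_pdivlMr ?mulr_gt0//; nra.
- by rewrite -mulrA mulr_gt0// -expr2 exprn_even_gt0.
- by case/andP: yb => p q; apply/andP; split; nra.
Qed.

(** The imaginary part of [H] is the real part of [- i H], which satisfies the same hypotheses. *)
Lemma cintegral_cross H H' (T b x0 M : R) : 0 < T -> 0 < b ->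
  (forall z, 0 <= complex.Re z <= T -> - b < complex.Im z < b -> z != x0%:C ->
     hol H z (H' z) /\ ccont H' z) ->
  (forall z, 0 <= complex.Re z <= T -> - b < complex.Im z < b -> cabs (H z) <= M) ->
  (forall y, - b < y < b -> H (0 +i* y) = H (T +i* y)) ->
  forall y, - b < y < b ->
  cintegral T (fun t => H (t +i* y)) = cintegral T (fun t => H t%:C).
Proof.
move=> T0 b0 hH HM per y yb; rewrite /cintegral.
rewrite (@Re_integral_cross H H' T b x0 M)//; congr (_ +i* _).
have E s : (fun t : R => complex.Im (H (t +i* s))) =
    (fun t => complex.Re (- 'i%C * H (t +i* s))).
  by apply/funext => t; rewrite ReNi.
rewrite -[RHS]/(\int[mu]_(x in `[0, T]) complex.Im (H (x +i* 0))) !E.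
apply: (@Re_integral_cross (fun z => - 'i%C * H z) (fun z => - 'i%C * H' z)
   T b x0 M) => //.
- move=> z zT zb zx; have [h1 h2] := hH z zT zb zx.
  by split; [exact: holZ|exact: ccontZ].
- by move=> z zT zb; rewrite cabsM cabsN cabs_i mul1r; exact: HM.
- by move=> s sb; rewrite per.
Qed.

End SingularContours.

(** * Fourier modes *)

Section ComplexIntegral.
Context {R : realType}.
Implicit Types (u v : R -> R[i]) (T M : R).
Local Notation mu := (@lebesgue_measure R).

Definition cintegrable T u : Prop :=
  mu.-integrable `[0, T] (EFin \o (fun t => complex.Re (u t))) /\
  mu.-integrable `[0, T] (EFin \o (fun t => complex.Im (u t))).

Lemma eq_cintegral T u v : (forall t, 0 <= t <= T -> u t = v t) ->
  cintegral T u = cintegral T v.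
Proof.
move=> uv; congr (_ +i* _); apply: eq_Rintegral => t; rewrite inE /= in_itv /=;
  by move=> /uv ->.
Qed.

Lemma integrableD_fun (g h k : R -> R) T :
  mu.-integrable `[0, T] (EFin \o g) -> mu.-integrable `[0, T] (EFin \o h) ->
  (forall t, k t = g t + h t) -> mu.-integrable `[0, T] (EFin \o k).
Proof.
move=> ig ih kE; rewrite (_ : _ \o _ = (EFin \o g) \+ (EFin \o h)).
  exact: integrableD.
by apply/funext => t /=; rewrite kE EFinD.
Qed.

Lemma integrableZ_fun (c : R) (g k : R -> R) T :
  mu.-integrable `[0, T] (EFin \o g) ->
  (forall t, k t = c * g t) -> mu.-integrable `[0, T] (EFin \o k).
Proof.
move=> ig kE; rewrite (_ : _ \o _ = fun t => (c%:E * (EFin \o g) t)%E).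
  exact: integrableZl.
by apply/funext => t /=; rewrite kE EFinM.
Qed.

Lemma cintegrableD T u v : cintegrable T u -> cintegrable T v ->
  cintegrable T (fun t => u t + v t).
Proof.
move=> [u1 u2] [v1 v2]; split.
- by apply: (integrableD_fun u1 v1) => t; rewrite ReD.
- by apply: (integrableD_fun u2 v2) => t; rewrite ImD.
Qed.

Lemma cintegralD T u v : cintegrable T u -> cintegrable T v ->
  cintegral T (fun t => u t + v t) = cintegral T u + cintegral T v.
Proof.
move=> [u1 u2] [v1 v2]; apply: complex_eq; rewrite ?ReD ?ImD /= -RintegralD//.
- by apply: eq_Rintegral => t _; rewrite ReD.
- by apply: eq_Rintegral => t _; rewrite ImD.
Qed.

Lemma ReM (c z : R[i]) : complex.Re (c * z) =
  complex.Re c * complex.Re z - complex.Im c * complex.Im z.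
Proof. by case: c z => ? ? [? ?]. Qed.

Lemma ImM (c z : R[i]) : complex.Im (c * z) =
  complex.Re c * complex.Im z + complex.Im c * complex.Re z.
Proof. by case: c z => ? ? [? ?]. Qed.

Lemma cintegrableZ T c u : cintegrable T u -> cintegrable T (fun t => c * u t).
Proof.
move=> [u1 u2]; split.
- apply: (@integrableD_fun (fun t => complex.Re c * complex.Re (u t))
    (fun t => - complex.Im c * complex.Im (u t))).
  + exact: integrableZ_fun u1 _.
  + exact: integrableZ_fun u2 _.
  + by move=> t; rewrite ReM mulNr.
- apply: (@integrableD_fun (fun t => complex.Re c * complex.Im (u t))
    (fun t => complex.Im c * complex.Re (u t))).
  + exact: integrableZ_fun u2 _.
  + exact: integrableZ_fun u1 _.
  + by move=> t; rewrite ImM.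
Qed.

Lemma cintegralZ T c u : cintegrable T u ->
  cintegral T (fun t => c * u t) = c * cintegral T u.
Proof.
move=> [u1 u2]; apply: complex_eq; rewrite ?ReM ?ImM /= -!RintegralZl//.
- rewrite -RintegralB//; [|exact: integrableZ_fun u1 _|exact: integrableZ_fun u2 _].
  by apply: eq_Rintegral => t _; rewrite ReM.
- rewrite -RintegralD//; [|exact: integrableZ_fun u2 _|exact: integrableZ_fun u1 _].
  by apply: eq_Rintegral => t _; rewrite ImM.
Qed.

Lemma cintegral0 T : cintegral T (fun=> 0) = 0.
Proof. by rewrite /cintegral /= Rintegral_cst// mul0r. Qed.

Lemma cintegral_cst T (c : R[i]) : 0 <= T -> cintegral T (fun=> c) = T%:C * c.
Proof.
move=> T0; have E : fine (mu `[0, T]) = T.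
  rewrite lebesgue_measure_itv /=; case: ifPn => [_|]; first by rewrite oppr0 addr0.
  by rewrite lte_fin -leNgt => T0'; apply/esym/eqP; rewrite eq_le T0 T0'.
apply: complex_eq; rewrite ?ReZ ?ImZ /= Rintegral_cst// [X in _ * fine X]/=.
all: by rewrite E mulrC.
Qed.

Lemma cintegrable0 T : cintegrable T (fun=> 0).
Proof. by split; rewrite /comp /=; exact: integrable0. Qed.

Lemma cintegrable_sum T n (F : 'I_n -> R -> R[i]) :
  (forall j, cintegrable T (F j)) -> cintegrable T (fun t => \sum_(j < n) F j t).
Proof.
elim: n F => [|n ih] F hF.
  by under eq_fun do rewrite big_ord0; exact: cintegrable0.
under eq_fun do rewrite big_ord_recr /=.
by apply: cintegrableD => //; exact: ih.
Qed.

Lemma cintegral_sum T n (F : 'I_n -> R -> R[i]) :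
  (forall j, cintegrable T (F j)) ->
  cintegral T (fun t => \sum_(j < n) F j t) = \sum_(j < n) cintegral T (F j).
Proof.
elim: n F => [|n ih] F hF.
  rewrite big_ord0 -[RHS](cintegral0 T); congr cintegral.
  by apply/funext => t; rewrite big_ord0.
rewrite big_ord_recr /= -ih// -cintegralD//; last exact: cintegrable_sum.
by congr cintegral; apply/funext => t; rewrite big_ord_recr.
Qed.

Lemma Rintegral_le_bound (g : R -> R) T M : 0 <= T ->
  mu.-integrable `[0, T] (EFin \o g) ->
  (forall t, 0 <= t <= T -> `|g t| <= M) ->
  `|\int[mu]_(t in `[0, T]) g t| <= T * M.
Proof.
move=> T0 ig gM.
have mI : measurable (`[0, T]%classic : set R) by exact: measurable_itv.
apply: (@le_trans _ _ (\int[mu]_(t in `[0, T]) `|g t|)).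
  exact: le_normr_Rintegral.
have iM : mu.-integrable `[0, T] (EFin \o (fun _ : R => M)).
  by apply: continuous_integrable => t _; exact: cvg_cst.
have E : \int[mu]_(t in `[0, T]) M = T * M.
  by have := congr1 (@complex.Re R) (@cintegral_cst T M%:C T0); rewrite ReZ.
rewrite -E; apply: le_Rintegral => //.
by rewrite (_ : EFin \o _ = abse \o (EFin \o g))//; exact: integrable_abse.
Qed.

(** The factor 2 comes from bounding the real and imaginary parts separately; it only affects the
    final constant. *)
Lemma cabs_cintegral_le T u M : 0 <= T -> cintegrable T u ->
  (forall t, 0 <= t <= T -> cabs (u t) <= M) ->
  cabs (cintegral T u) <= 2 * (T * M).
Proof.
move=> T0 [u1 u2] uM; apply: le_trans (cabs_le _) _ => /=.
rewrite mulrDl !mul1r; apply: lerD; apply: Rintegral_le_bound => // t tT.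
- exact: le_trans (Re_le_cabs _) (uM t tT).
- exact: le_trans (Im_le_cabs _) (uM t tT).
Qed.

Lemma cintegrable_ccont T (y : R) (f : R[i] -> R[i]) :
  (forall t, 0 <= t <= T -> ccont f (t +i* y)) ->
  cintegrable T (fun t => f (t +i* y)).
Proof.
move=> cf; split; apply: continuous_integrable => t /cf.
  exact: ccont_Re_horizontal.
move=> /(ccontZ (- 'i%C)) /ccont_Re_horizontal.
by rewrite /prop_for (_ : (fun s : R => _) = fun s => complex.Im (f (s +i* y)))//;
  apply/funext => s; rewrite ReNi.
Qed.

Lemma cintegrable_bounded T (y x0 M : R) (f : R[i] -> R[i]) :
  (forall t, 0 <= t <= T -> t != x0 -> ccont f (t +i* y)) ->
  (forall t, 0 <= t <= T -> cabs (f (t +i* y)) <= M) ->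
  cintegrable T (fun t => f (t +i* y)).
Proof.
move=> cf fM; split.
  apply: (@bounded_continuous_off_integrable _ _ _ _ x0 M) => t tT.
    by move=> /(cf t tT) /ccont_Re_horizontal.
  exact: le_trans (Re_le_cabs _) (fM t tT).
apply: (@bounded_continuous_off_integrable _ _ _ _ x0 M) => t tT.
  move=> /(cf t tT) /(ccontZ (- 'i%C)) /ccont_Re_horizontal.
  by rewrite /prop_for (_ : (fun s : R => _) = fun s => complex.Im (f (s +i* y)))//;
    apply/funext => s; rewrite ReNi.
exact: le_trans (Im_le_cabs _) (fM t tT).
Qed.

End ComplexIntegral.

(** * Orthogonality of the modes, and the solutions of [q = 1] *)

Section Modes.
Context {R : realType}.
Implicit Types (T x y t a : R) (k : int) (z : R[i]).

Lemma omegaD T a b : omega T (a + b) = omega T a + omega T b.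
Proof. by rewrite /omega; ring. Qed.

Lemma omegaN T a : omega T (- a) = - omega T a.
Proof. by rewrite /omega; ring. Qed.

Lemma omega0 T : omega T 0 = 0.
Proof. by rewrite /omega mulr0 mul0r. Qed.

Lemma omega_gt0 T a : 0 < T -> 0 < a -> 0 < omega T a.
Proof. by move=> T0 a0; rewrite /omega divr_gt0// mulr_gt0// mulr_gt0// pi_gt0. Qed.

Lemma cis_2pi_nat (n : nat) : cis (2 * pi * n%:R : R) = 1.
Proof.
elim: n => [|n ih]; first by rewrite mulr0 cis0.
by rewrite -[n.+1%:R]natr1 mulrDr mulr1 cisD ih mul1r /cis mulr_natl cos2pi sin2pi.
Qed.

Lemma cis_2pi_int k : cis (2 * pi * k%:~R : R) = 1.
Proof.
case: k => n; first exact: cis_2pi_nat.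
rewrite NegzE mulrNz mulrN.
have := cisD (2 * pi * n.+1%:R) (- (2 * pi * n.+1%:R) : R).
by rewrite subrr cis0 cis_2pi_nat mul1r => <-.
Qed.

Lemma cexpi_periodic T k x y : T != 0 ->
  cexpi (omega T k%:~R) (T +i* y - x%:C) = cexpi (omega T k%:~R) (0 +i* y - x%:C).
Proof.
move=> T0; have -> : T +i* y - x%:C = T%:C + (0 +i* y - x%:C) by simpc.
rewrite cexpiD cexpi_real.
by rewrite /omega divfK// cis_2pi_int mul1r.
Qed.

Lemma hol_cexpi_shift a c z :
  hol (fun w => cexpi a (w - c)) z ('i%C * a%:C * cexpi a (z - c)).
Proof.
move=> e e0; have [D D0 hD] := @hol_cexpi R a (z - c) e e0; exists D => // h /hD.
by rewrite (_ : z - c + h = z + h - c)//; ring.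
Qed.

(** Moving the contour to height 1 leaves the integral unchanged, yet multiplies it by [e^(- a)],
    which differs from 1 because [a] is not 0. *)
Lemma cintegral_mode T k x : 0 < T -> k != 0 ->
  cintegral T (fun t => cexpi (omega T k%:~R) (t%:C - x%:C)) = 0.
Proof.
move=> T0 k0; set a := omega T _.
have a0 : a != 0.
  rewrite /a /omega; apply: mulf_neq0; last by rewrite invr_eq0 gt_eqF.
  by apply: mulf_neq0; [rewrite gt_eqF// mulr_gt0// pi_gt0|rewrite intr_eq0].
pose E z := cexpi a (z - x%:C).
pose E' z := 'i%C * a%:C * cexpi a (z - x%:C).
have hE z : hol E z (E' z) by exact: hol_cexpi_shift.
have cE z : ccont E z by exact: hol_ccont (hE z).
have cE' z : ccont E' z by exact: ccontZ (cE z).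
have ImE z : complex.Im (z - x%:C) = complex.Im z.
  by rewrite ImB /= subr0.
have EM z : 0 <= complex.Re z <= T -> -2 < complex.Im z < 2 ->
    cabs (E z) <= expR (`|a| * 2).
  move=> _ /andP[z1 z2]; rewrite cabs_cexpi ImE ler_expR.
  apply: le_trans (ler_norm _) _; rewrite normrN normrM ler_wpM2l//.
  by rewrite ler_norml !ltW//; lra.
have per y : -2 < y < 2 -> E (0 +i* y) = E (T +i* y).
  by move=> _; rewrite /E cexpi_periodic// gt_eqF.
have l1 : - (2 : R) < (1 : R) by lra.
have l2 : (1 : R) < (2 : R) by lra.
have := @cintegral_cross R E E' T 2 0 _ T0 (ltr0Sn R 1) (fun z _ _ _ => conj (hE z) (cE' z))
   EM per 1 (introT andP (conj l1 l2)).
have -> : (fun t => E (t +i* 1)) = fun t => (expR (- a))%:C * E t%:C.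
  apply/funext => t.
  rewrite /E (_ : t +i* 1 - x%:C = (t%:C - x%:C) + (0 +i* 1)); last by simpc.
  by rewrite cexpiD mulrC /cexpi /= !mulr1 mulr0 cis0 mulr1.
rewrite cintegralZ; last first.
  exact: (@cintegrable_ccont R T 0 E (fun t _ => cE (t +i* 0))).
move=> /eqP; rewrite -subr_eq0 -{2}[cintegral _ _]mul1r -mulrBl mulf_eq0.
case/orP => [|/eqP//]; rewrite subr_eq0 => /eqP /(congr1 (@complex.Re R)) /= ea.
have : - a = 0 by apply: expR_inj; rewrite ea expR0.
by move/eqP; rewrite oppr_eq0 (negbTE a0).
Qed.

Lemma cos_eq1 (th : R) : `|th| < 2 * pi -> cos th = 1 -> th = 0.
Proof.
move=> th2 c1; have E : th = th / 2 + th / 2 by rewrite -splitr.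
have s0 : sin (th / 2) = 0.
  move: c1; rewrite {1}E cosD -!expr2 cos2sin2 => h; apply/eqP.
  by rewrite -sqrf_eq0; apply/eqP; lra.
have [h|h|//] := ltgtP th 0.
- have : 0 < sin (- (th / 2)).
    by apply: sin_gt0_pi; move: th2; rewrite ltr0_norm// => ?; apply/andP; split; lra.
  by rewrite sinN s0 oppr0 ltxx.
- have : 0 < sin (th / 2).
    by apply: sin_gt0_pi; move: th2; rewrite gtr0_norm// => ?; apply/andP; split; lra.
  by rewrite s0 ltxx.
Qed.

(** Modulus 1 puts [z] on the real axis. As [x] is interior, [|z - x| < T] even at the endpoints, so
    the phase stays strictly below a full turn. *)
Lemma mode1_eq1 T x z : 0 < T -> 0 < x < T -> 0 <= complex.Re z <= T ->
  z != x%:C -> cexpi (omega T 1) (z - x%:C) != 1.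
Proof.
move=> T0 /andP[x0 xT] /andP[z0 zT]; apply: contraNneq => h.
have w0 : 0 < omega T 1 by exact: omega_gt0.
have /expR_inj/eqP : expR (- (omega T 1 * complex.Im (z - x%:C))) = expR 0.
  by rewrite -cabs_cexpi h cabs1 expR0.
rewrite ImB subr0 oppr_eq0 mulf_eq0 gt_eqF//= => /eqP i0.
have zE : z = (complex.Re z)%:C by apply: complex_eq.
move: h; rewrite {1}zE -rmorphB cexpi_real => /(congr1 (@complex.Re R)) /= c1.
have th : `|omega T 1 * (complex.Re z - x)| < 2 * pi.
  rewrite normrM gtr0_norm// /omega mulr1 mulrAC ltr_pdivrMr//.
  rewrite ltr_pM2l ?mulr_gt0 ?pi_gt0//.
  by rewrite ltr_norml; apply/andP; split; lra.
have /eqP := cos_eq1 th c1; rewrite mulf_eq0 gt_eqF//= subr_eq0 => /eqP zx.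
by rewrite zE zx eqxx.
Qed.

End Modes.

(** * Dirichlet kernel estimate *)

Section FourierError.
Context {R : realType}.
Implicit Types (T x y t a b M : R) (k : int) (z : R[i]).

(** Geometric sum over the frequencies [m], [m - 1], ..., [m - N + 1]; the Dirichlet kernel is the
    case of [m = n] and [2n + 1] terms. *)
Lemma sum_modes T (z : R[i]) (m : int) (N : nat) :
  (cexpi (omega T 1) z - 1) * (\sum_(j < N) cexpi (omega T (m - j%:Z)%:~R) z) =
  cexpi (omega T (m + 1)%:~R) z - cexpi (omega T (m + 1 - N%:Z)%:~R) z.
Proof.
have S k : cexpi (omega T 1) z * cexpi (omega T k%:~R) z =
    cexpi (omega T (k + 1)%:~R) z.
  by rewrite -cexpi_addl -omegaD addrC intrD.
elim: N => [|N ih]; first by rewrite big_ord0 mulr0 subr0 subrr.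
rewrite big_ord_recr /= mulrDr ih mulrBl mul1r S.
have -> : m - N%:Z + 1 = m + 1 - N%:Z by rewrite addrAC.
have -> : m + 1 - N.+1%:Z = m - N%:Z by rewrite -addn1 PoszD; ring.
by ring.
Qed.

(** The 8 is a product of three factors 2: one for the two halves of the kernel, one for
    [|f z - f x| <= 2 M], one from [cabs_cintegral_le]. The strict [b' < b] leaves room for
    [cintegral_cross], which works in an open strip. *)
Lemma fourier_error (f f' f'' : R[i] -> R[i]) (T b b' M x : R) (N : nat) :
  0 < T -> 0 < b' < b -> ~~ odd N ->
  (forall z, 0 <= complex.Re z <= T -> - b <= complex.Im z <= b ->
     [/\ hol f z (f' z), hol f' z (f'' z) & cabs (f z) <= M]) ->
  (forall y, - b <= y <= b -> f (0 +i* y) = f (T +i* y)) ->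
  0 < x < T ->
  cabs (f x%:C - fourier_trunc T N (fun t => f t%:C) x) <=
    8 * M * expR (- omega T b') ^+ (N./2).+1 / (1 - expR (- omega T b')).
Proof.
move=> T0 /andP[b'0 b'b] evN hf per xT; set r := expR _.
have T0' : T != 0 by rewrite gt_eqF.
have b0 : 0 < b by exact: lt_trans b'b.
have b'bb : - b < b' < b by rewrite b'b andbT; lra.
have b'bb' : - b < - b' < b by apply/andP; split; lra.
have r0 : 0 < r by exact: expR_gt0.
have w0 : 0 < omega T 1 by exact: omega_gt0.
have wb0 : 0 < omega T b' by exact: omega_gt0.
have r1 : r < 1 by rewrite -[ltRHS]expR0 ltr_expR oppr_lt0.
pose n := N./2.
have NE : N = (n + n)%N by rewrite addnn -{1}[N]odd_double_half (negbTE evN).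
pose E k z := cexpi (omega T k%:~R) (z - x%:C).
pose q z := cexpi (omega T 1) (z - x%:C).
(* At [z = x] this is the inverse of 0, hence 0, so [H k] need not be continuous there; only its
   boundedness is used. *)
pose V z := (q z - 1)^-1.
pose V' z := ((- ('i%C * (omega T 1)%:C)) * q z) * (V z * V z).
pose E' k z := 'i%C * (omega T k%:~R)%:C * E k z.
pose F1 z := f z - f x%:C.
pose H k z := F1 z * V z * E k z.
pose H' k z := (f' z * V z + F1 z * V' z) * E k z + F1 z * V z * E' k z.
have rx : 0 <= complex.Re x%:C <= T by case/andP: xT => /ltW a1 /ltW a2; rewrite /= a1.
have ix : - b <= complex.Im x%:C <= b by apply/andP; split=> /=; lra.
have M0 : 0 <= M by have [_ _] := hf _ rx ix; apply: le_trans; exact: cabs_ge0.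
have fx : cabs (f x%:C) <= M by have [] := hf _ rx ix.
have hE k z : hol (E k) z (E' k z) by exact: hol_cexpi_shift.
have hE' k z : hol (E' k) z ('i%C * (omega T k%:~R)%:C * E' k z) by exact: holZ.
have hq z : hol q z ('i%C * (omega T 1)%:C * q z) by exact: hol_cexpi_shift.
have q1 z : 0 <= complex.Re z <= T -> z != x%:C -> q z - 1 != 0.
  by move=> zT zx; rewrite subr_eq0; exact: mode1_eq1.
have hV z : 0 <= complex.Re z <= T -> z != x%:C -> hol V z (V' z).
  move=> zT zx; have := holV (holB (hq z) (hol_cst 1 z)) (q1 z zT zx).
  by rewrite subr0 /V' !mulNr.
have hV' z : 0 <= complex.Re z <= T -> z != x%:C -> exists d, hol V' z d.
  by move=> zT zx; have h := hV z zT zx; eexists; exact: holM (holZ _ (hq z)) (holM h h).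
have hF1 z : 0 <= complex.Re z <= T -> - b <= complex.Im z <= b -> hol F1 z (f' z).
  by move=> zT zb; have [h _ _] := hf z zT zb; have := holB h (hol_cst (f x%:C) z); rewrite subr0.
have hH k z : 0 <= complex.Re z <= T -> - b <= complex.Im z <= b -> z != x%:C ->
    hol (H k) z (H' k z) /\ ccont (H' k) z.
  move=> zT zb zx; have [_ h' _] := hf z zT zb.
  have h1 := hF1 z zT zb; have h2 := hV z zT zx; have [d h3] := hV' z zT zx.
  split; first exact: holM (holM h1 h2) (hE k z).
  exact: hol_ccont (holD (holM (holD (holM h' h2) (holM h1 h3)) (hE k z))
    (holM (holM h1 h2) (hE' k z))).
have cH k z : cabs (H k z) = cabs (F1 z) * cabs (V z) * cabs (E k z).
  by rewrite /H (cabsM _ (E k z)) (cabsM (F1 z)).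
have bdd k : exists K, forall z, 0 <= complex.Re z <= T -> - b <= complex.Im z <= b ->
    cabs (H k z) <= K.
  apply: rect_bounded => z zT zb.
  have [zx|zx] := eqVneq z x%:C; last first.
    have [/hol_ccont c _] := hH k z zT zb zx; have [D D0 hD] := c 1 ltr01.
    exists (cabs (H k z) + 1), D; split => // h /hD.
    by have := cabs_lerB (H k (z + h)) (H k z); lra.
  (* Near [x] the numerator is at most [A |h|]. The derivative of [q] at [x] has modulus
     [omega T 1]; allowing an error of half of it leaves [|q - 1| >= (omega T 1 / 2) |h|], so the
     quotient is bounded. *)
  have [D1 D10 h1] := hol_lipschitz (hF1 z zT zb).
  have [D2 D20 h2] := hol_ccont (hE k z) ltr01.
  have w2 : 0 < omega T 1 / 2 by rewrite divr_gt0.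
  have [D3 D30 h3] := hq z _ w2.
  set A := cabs (f' z) + 1 in h1.
  have A0 : 0 <= A by rewrite addr_ge0 ?cabs_ge0.
  exists (A * (omega T 1 / 2)^-1 * (cabs (E k z) + 1)), (Num.min (Num.min D1 D2) D3).
  split; first by rewrite !lt_min D10 D20.
  move=> h; rewrite !lt_min => /andP[/andP[/h1 {}h1 /h2 {}h2] /h3 {}h3].
  have F1z : F1 z = 0 by rewrite /F1 zx subrr.
  have qz : q z = 1 by rewrite /q zx subrr cexpi0.
  rewrite F1z subr0 in h1; rewrite qz mulr1 in h3.
  rewrite cH; apply: ler_pM; rewrite ?mulr_ge0 ?cabs_ge0//; last first.
    by have := cabs_lerB (E k (z + h)) (E k z); lra.
  have [->|hn0] := eqVneq h 0.
    by rewrite addr0 F1z cabs0 mul0r mulr_ge0// invr_ge0 ltW.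
  have ch : 0 < cabs h by rewrite cabs_gt0.
  have qh : omega T 1 / 2 * cabs h <= cabs (q (z + h) - 1).
    have := cabs_lerB ('i%C * (omega T 1)%:C * h) (- (q (z + h) - 1 - 'i%C * (omega T 1)%:C * h)).
    rewrite opprK (_ : _ + (_ - _) = q (z + h) - 1); last by ring.
    by rewrite cabsN !cabsM cabs_i mul1r cabsR gtr0_norm//; lra.
  have qh0 : 0 < omega T 1 / 2 * cabs h by rewrite mulr_gt0.
  rewrite /V cabsV; apply: (@le_trans _ _ (A * cabs h * (omega T 1 / 2 * cabs h)^-1)).
    apply: ler_pM => //; rewrite ?cabs_ge0 ?invr_ge0 ?cabs_ge0//.
    by rewrite lef_pV2 ?posrE//; exact: lt_le_trans qh.
  by rewrite invfM mulrACA divff ?mulr1// gt_eqF.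
have ImE z : complex.Im (z - x%:C) = complex.Im z by rewrite ImB /= subr0.
have cE k t y : cabs (E k (t +i* y)) = expR (- (omega T k%:~R * y)).
  by rewrite cabs_cexpi ImE.
have cq t y : cabs (q (t +i* y)) = expR (- (omega T 1 * y)).
  by rewrite cabs_cexpi ImE.
have F1M z : 0 <= complex.Re z <= T -> - b <= complex.Im z <= b -> cabs (F1 z) <= 2 * M.
  by move=> zT zb; have [_ _ h] := hf z zT zb; apply: le_trans (cabsB _ _) _; lra.
have perH k y : - b < y < b -> H k (0 +i* y) = H k (T +i* y).
  move=> /andP[y1 y2]; have yb : - b <= y <= b by rewrite !ltW.
  rewrite /H /F1 /V /E /q per// cexpi_periodic//.
  by have := @cexpi_periodic R T 1 x y T0'; rewrite mulr1z => ->.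
have cross k y : - b < y < b ->
    cintegral T (fun t => H k (t +i* y)) = cintegral T (fun t => H k t%:C).
  have [K hK] := bdd k; apply: (@cintegral_cross R (H k) (H' k) T b x K) => //.
  - by move=> z zT /andP[/ltW z1 /ltW z2]; apply: hH => //; rewrite z1.
  - by move=> z zT /andP[/ltW z1 /ltW z2]; apply: hK => //; rewrite z1.
  - by move=> s; exact: perH.
have offx t y : t != x -> t +i* y != x%:C by apply: contra => /eqP[-> _].
have offy t y : y != 0 -> t +i* y != x%:C by apply: contra => /eqP[_ ->].
have intH k y : - b < y < b -> cintegrable T (fun t => H k (t +i* y)).
  move=> /andP[/ltW y1 /ltW y2]; have yb : - b <= y <= b by rewrite y1.
  have [K hK] := bdd k; apply: (@cintegrable_bounded R T y x K (H k)).
    by move=> t tT tx; have [/hol_ccont] := hH k (t +i* y) tT yb (offx _ _ tx).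
  by move=> t tT; exact: hK.
have bb0 : - b < 0 < b by rewrite b0 andbT oppr_lt0.
pose B := 2 * M * (r ^+ n.+1 / (1 - r)).
have wbE : omega T 1 * b' = omega T b' by rewrite /omega; ring.
have I1 : cabs (cintegral T (fun t => H n.+1%:Z t%:C)) <= 2 * (T * B).
  rewrite -(cross _ b' b'bb); apply: cabs_cintegral_le; [exact: ltW|exact: intH|].
  move=> t tT; rewrite cH cE -[leLHS]mulrA /B; apply: ler_pM.
  - exact: cabs_ge0.
  - by apply: mulr_ge0; [exact: cabs_ge0|exact: expR_ge0].
  - by apply: F1M => //=; case/andP: b'bb => /ltW -> /ltW ->.
  have -> : expR (- (omega T (n.+1%:Z)%:~R * b')) = r ^+ n.+1.
    by rewrite -expRM_natl; congr expR; rewrite /omega; ring.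
  rewrite mulrC; apply: ler_wpM2l; first exact/exprn_ge0/ltW.
  rewrite /V cabsV lef_pV2 ?posrE ?subr_gt0//.
    have := cabs_lerB 1 (q (t +i* b')); rewrite cabs1 cq wbE -/r.
    by rewrite cabsC.
  by rewrite cabs_gt0; apply: q1 => //; apply: offy; rewrite gt_eqF.
have I2 : cabs (cintegral T (fun t => H (- n%:Z) t%:C)) <= 2 * (T * B).
  rewrite -(cross _ (- b') b'bb'); apply: cabs_cintegral_le; [exact: ltW|exact: intH|].
  move=> t tT; rewrite cH cE -[leLHS]mulrA /B; apply: ler_pM.
  - exact: cabs_ge0.
  - by apply: mulr_ge0; [exact: cabs_ge0|exact: expR_ge0].
  - by apply: F1M => //=; case/andP: b'bb' => /ltW -> /ltW ->.
  have -> : expR (- (omega T (- n%:Z)%:~R * - b')) = r ^+ n.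
    by rewrite -expRM_natl; congr expR; rewrite mulrNz /omega; ring.
  rewrite mulrC exprSr -mulrA; apply: ler_wpM2l; first exact/exprn_ge0/ltW.
  (* On the lower line the mode yields only [r ^+ n]. The missing factor [r] comes from
     [|q| = r^-1], which makes [|q - 1|] at least [r^-1 - 1]. *)
  have -> : r / (1 - r) = (r^-1 - 1)^-1.
    have rn0 : r != 0 by rewrite gt_eqF.
    have r10 : 1 - r != 0 by rewrite gt_eqF// subr_gt0.
    by field; rewrite rn0 mulN1r.
  have rV1 : 0 < r^-1 - 1 by rewrite subr_gt0 invf_gt1.
  rewrite /V cabsV lef_pV2 ?posrE//.
    have := cabs_lerB (q (t +i* - b')) 1; rewrite cabs1 cq mulrN opprK wbE.
    by rewrite /r expRN invrK.
  by rewrite cabs_gt0; apply: q1 => //; apply: offy; rewrite oppr_eq0 gt_eqF.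
have cEk k : cintegrable T (fun t => E k t%:C).
  by apply: (@cintegrable_ccont R T 0 (E k)) => t _; exact: hol_ccont (hE k _).
have cfE k : cintegrable T (fun t => f t%:C * E k t%:C).
  apply: (@cintegrable_ccont R T 0 (fun z => f z * E k z)) => t tT.
  have tb : - b <= complex.Im (t +i* 0) <= b by apply/andP; split=> /=; lra.
  have [h _ _] := hf (t +i* 0) tT tb.
  exact: hol_ccont (holM h (hE k _)).
(* [E (- freq j) t] is [e^(i omega_k (x - t))] with [k = freq j]: the mode at [x] times the
   conjugate mode at [t]. At [t = x], where [q - 1] cannot be cancelled, both sides are 0 because
   [F1 x = 0]. *)
have DE t : 0 <= t <= T -> H n.+1%:Z t%:C - H (- n%:Z) t%:C =
    \sum_(j < N.+1) f t%:C * E (- freq j) t%:C -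
    f x%:C * \sum_(j < N.+1) E (- freq j) t%:C.
  move=> tT; rewrite -mulr_sumr -mulrBl -/(F1 _) /H.
  have [->|tx] := eqVneq t x; first by rewrite /F1 subrr !mul0r subrr.
  have q10 : q t%:C - 1 != 0 by apply: q1 => //; exact: (offx t 0).
  rewrite -mulrBr -mulrA; congr (_ * _).
  apply: (mulfI q10); rewrite /V mulrA divff// mul1r.
  have -> : \sum_(j < N.+1) E (- freq j) t%:C =
     \sum_(j < N.+1) cexpi (omega T (n%:Z - j%:Z)%:~R) (t%:C - x%:C).
    by apply: eq_bigr => j _; rewrite /E /freq opprB.
  have e1 : n.+1%:Z = n%:Z + 1 by rewrite -addn1 PoszD.
  have e2 : - n%:Z = n%:Z + 1 - N.+1%:Z by rewrite NE -addn1 !PoszD; ring.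
  by rewrite e1 e2 (sum_modes T (t%:C - x%:C) n N.+1).
have modeE j : (T^-1)%:C * cintegral T (fun t => f t%:C * E (- freq j) t%:C) =
    fourier_coef T (fun t => f t%:C) (freq j) * fourier_mode T (freq j) x.
  rewrite /fourier_coef -mulrA; congr (_ * _); rewrite [RHS]mulrC -cintegralZ.
    apply: eq_cintegral => t _; rewrite [RHS]mulrCA; congr (_ * _).
    rewrite /E -rmorphB cexpi_real /fourier_mode -cisD; congr cis.
    by rewrite mulrNz omegaN; ring.
  have -> : (fun t => f t%:C * cis (- (omega T (freq j)%:~R * t))) =
    fun t => cis (- (omega T (freq j)%:~R * x)) * (f t%:C * E (- freq j) t%:C).
    apply/funext => t; rewrite [RHS]mulrCA; congr (_ * _).
    rewrite /E -rmorphB cexpi_real -cisD; congr cis.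
    by rewrite mulrNz omegaN; ring.
  exact: cintegrableZ.
(* Only the index [j = n], of frequency 0, contributes. *)
have sumE : \sum_(j < N.+1) cintegral T (fun t => E (- freq j) t%:C) = T%:C.
  have nN : (n < N.+1)%N by rewrite ltnS NE leq_addr.
  rewrite (bigD1 (Ordinal nN))//= big1 ?addr0.
    have -> : freq (Ordinal nN) = 0 by rewrite /freq /= subrr.
    rewrite oppr0 -[RHS]mulr1 -(cintegral_cst 1 (ltW T0)); apply: eq_cintegral => t _.
    by rewrite /E mulr0z omega0 /cexpi !mul0r oppr0 expR0 mul1r cis0.
  move=> j jn; apply: cintegral_mode => //; rewrite oppr_eq0 /freq subr_eq0.
  by apply: contra jn => /eqP[jn]; apply/eqP/val_inj.
have cDE : cintegral T (fun t => H n.+1%:Z t%:C) - cintegral T (fun t => H (- n%:Z) t%:C)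
   = T%:C * (fourier_trunc T N (fun t => f t%:C) x - f x%:C).
  rewrite -[X in _ - X]mul1r -mulNr -cintegralZ; last exact: (intH _ 0 bb0).
  rewrite -cintegralD; [|exact: (intH _ 0 bb0)|exact/cintegrableZ/(intH _ 0 bb0)].
  transitivity (cintegral T (fun t => \sum_(j < N.+1) f t%:C * E (- freq j) t%:C +
      (- f x%:C) * \sum_(j < N.+1) E (- freq j) t%:C)).
    by apply: eq_cintegral => t tT; rewrite mulN1r DE// mulNr.
  rewrite cintegralD; last 2 first.
  - exact: cintegrable_sum.
  - by apply: cintegrableZ; exact: cintegrable_sum.
  rewrite cintegralZ; last exact: cintegrable_sum.
  rewrite !cintegral_sum// sumE mulNr mulrBr [f _ * _]mulrC; congr (_ - _).
  rewrite /fourier_trunc mulr_sumr; apply: eq_bigr => j _.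
  by rewrite -modeE mulrA -rmorphM divff// mul1r.
have : T * cabs (f x%:C - fourier_trunc T N (fun t => f t%:C) x) <= 2 * (T * B) + 2 * (T * B).
  rewrite cabsC -[X in X * _](gtr0_norm T0) -cabsR -cabsM -cDE.
  by apply: le_trans (cabsB _ _) _; exact: lerD.
have -> : 2 * (T * B) + 2 * (T * B) = T * (8 * M * r ^+ n.+1 / (1 - r)).
  by rewrite /B; ring.
by rewrite ler_pM2l.
Qed.

End FourierError.

(** * Smooth bump functions *)

Section TestFunctions.
Context {R : realType}.
Implicit Types (P Q : {poly R}) (x a b s : R).
Local Notation mu := (@lebesgue_measure R).

(* The functions [P(1/x) exp(-1/x)] form a class closed under derivation, which
   gives smoothness without computing higher derivatives. *)
Definition flat P x : R := if 0 < x then P.[x^-1] * expR (- x^-1) else 0.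

(** With [s = 1/x], [P(s) e^(-s)] has derivative [(P' - P)(s) e^(-s)] in [s], and
    [ds/dx = - s^2]. *)
Definition flat_deriv P : {poly R} := 'X^2 * (P - P^`()).

(** The power [s ^+ k] serves the induction, where multiplication of [P] by the variable raises [k]
    by one. *)
Lemma poly_expR_bound P k : exists2 C : R, 0 <= C &
  forall s, 0 <= s -> `|P.[s]| * s ^+ k * expR (- s) <= C.
Proof.
elim/poly_ind: P k => [|P c ih] k.
  by exists 0 => // s _; rewrite horner0 normr0 !mul0r.
have [C C0 hC] := ih k.+1.
exists (C + `|c| * (k`!%:R + 1)).
  by rewrite addr_ge0// mulr_ge0// addr_ge0.
move=> s s0; rewrite hornerMXaddC.
have e0 : 0 < expR (- s) := expR_gt0 _.
have hk : s ^+ k * expR (- s) <= k`!%:R + 1.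
  rewrite expRN ler_pdivrMr ?expR_gt0//.
  case: k {hC} => [|k].
    have := expR_ge1Dx s; rewrite fact0 expr0; nra.
  have f0 : 0 < (k.+1)`!%:R :> R by rewrite ltr0n fact_gt0.
  have := expR_ge1Dxn k s0; rewrite -lerBrDl ler_pdivrMr// => h.
  have := expR_gt0 s; nra.
apply: (@le_trans _ _ (`|P.[s]| * s ^+ k.+1 * expR (- s) + `|c| * (s ^+ k * expR (- s)))).
  have -> : `|P.[s]| * s ^+ k.+1 * expR (- s) + `|c| * (s ^+ k * expR (- s)) =
    (`|P.[s]| * s + `|c|) * s ^+ k * expR (- s) by rewrite exprS; ring.
  apply: ler_wpM2r; first exact: ltW.
  apply: ler_wpM2r; first exact: exprn_ge0.
  by apply: le_trans (ler_normD _ _) _; rewrite normrM (ger0_norm s0).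
by apply: lerD; [exact: hC|exact: ler_wpM2l].
Qed.

Lemma flat_le0 P x : x <= 0 -> flat P x = 0.
Proof. by rewrite /flat ltNge => ->. Qed.

Lemma is_derive_local (g h : R -> R) x d (D : R) : 0 < D ->
  (forall y, `|y - x| < D -> g y = h y) -> is_derive x 1 h d -> is_derive x 1 g d.
Proof.
move=> D0 gh /is_derive_littleo hd; apply/is_derive_littleo => e e0.
have [D' D'0 hD'] := hd _ e0; exists (Num.min D D'); first by rewrite lt_min D0.
move=> t; rewrite lt_min => /andP[tD /hD'].
by rewrite -!gh// ?subrr ?normr0// addrAC subrr add0r.
Qed.

Lemma is_derive_flat P x : is_derive x 1 (flat P) (flat (flat_deriv P) x).
Proof.
have [x0|x0|->] := ltgtP x 0.
- rewrite (flat_le0 _ (ltW x0)).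
  apply: (@is_derive_local _ (cst 0) _ _ (- x)); first by rewrite oppr_gt0.
    move=> y; rewrite ltr_norml => /andP[_ yx]; apply: flat_le0; lra.
- apply: (@is_derive_local _ (fun y => (fun s => P.[s] * expR (- s)) y^-1) _ _ x) => //.
    by move=> y; rewrite ltr_norml /flat => /andP[yx _]; rewrite ifT//; lra.
  have xn0 : x != 0 by rewrite gt_eqF.
  have dinv : is_derive x 1 (fun y : R => y^-1) (- x ^- 2).
    by have := @is_deriveV R id x 1 1 xn0 (is_derive_id _ _); rewrite /GRing.scale /= mulr1.
  have dexp : is_derive x^-1 1 (fun s => expR (- s)) (- expR (- x^-1)).
    have := @is_derive_mull R expR (- 1) x^-1 _ (is_derive_expR _).
    rewrite !mulN1r; under eq_fun do rewrite mulN1r; exact.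
  have dG := @is_deriveM R R (horner P) (fun s => expR (- s)) x^-1 1 _ _
    (is_derive_poly P x^-1) dexp.
  have := @is_derive1_comp R _ (fun y => y^-1) x _ _ dG dinv.
  congr (is_derive _ _ _ _); rewrite /flat x0 /flat_deriv /GRing.scale /= !hornerE /=.
  by rewrite exprVn; ring.
- rewrite flat_le0//; apply/is_derive_littleo => e e0.
  (* One power of [1/h] pays for the difference quotient, the other makes it tend to 0. *)
  have [C C0 hC] := poly_expR_bound P 2.
  have C1 : 0 < C + 1 by rewrite ltr_wpDl.
  exists (e / (C + 1)); first by rewrite divr_gt0.
  move=> h he; rewrite add0r (flat_le0 _ (lexx 0)) subr0 mul0r subr0 /flat.
  case: ifPn => [h0|_]; last by rewrite normr0 mulr_ge0// ltW.
  have hE : `|h| = h by exact: gtr0_norm.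
  rewrite hE in he *; move: he; rewrite ltr_pdivlMr// => he.
  rewrite normrM (ger0_norm (expR_ge0 _)).
  have hV0 : 0 <= h^-1 by rewrite invr_ge0 ltW.
  have := hC _ hV0; rewrite mulrAC exprVn ler_pdivrMr ?exprn_gt0// => hh.
  apply: le_trans hh _; rewrite expr2 mulrA; apply: ler_wpM2r; first exact: ltW.
  by nra.
Qed.

Lemma flat1E x : flat 1 x = if 0 < x then expR (- x^-1) else 0.
Proof. by rewrite /flat hornerC mul1r. Qed.

Lemma flat1_gt0 x : 0 < x -> 0 < flat 1 x.
Proof. by move=> x0; rewrite flat1E x0 expR_gt0. Qed.

Lemma flat1_ge0 x : 0 <= flat 1 x.
Proof. by rewrite flat1E; case: ifP => // _; exact: expR_ge0. Qed.

Lemma flatN P x : flat (- P) x = - flat P x.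
Proof. by rewrite /flat; case: ifP; rewrite ?oppr0// hornerN mulNr. Qed.

(** By the Leibniz rule, finite sums of such products are closed under derivation, which single
    products are not. The list records the polynomials. *)
Definition flat_pairs a b (L : seq ({poly R} * {poly R})) x : R :=
  \sum_(p <- L) flat p.1 (x - a) * flat p.2 (b - x).

Definition flat_pairs_deriv (L : seq ({poly R} * {poly R})) :=
  flatten [seq [:: (flat_deriv p.1, p.2); (p.1, - flat_deriv p.2)] | p <- L].

Lemma is_derive_flat_pairs a b L x :
  is_derive x 1 (flat_pairs a b L) (flat_pairs a b (flat_pairs_deriv L) x).
Proof.
elim: L => [|[P Q] L ih].
  rewrite /flat_pairs big_nil (_ : (fun _ => _) = cst 0); first exact: (@is_derive_cst R R R 0 x 1).
  by apply/funext => y; rewrite big_nil.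
have -> : flat_pairs a b ((P, Q) :: L) =
    ((fun x => flat P (x - a)) * (fun x => flat Q (b - x))) + flat_pairs a b L.
  by apply/funext => y; rewrite /flat_pairs big_cons.
have d1 : is_derive x 1 (fun x : R => x - a) 1.
  have := @is_deriveB R R R id (cst a) x 1 1 0 (is_derive_id _ _) (is_derive_cst _ _ _).
  by rewrite subr0.
have d2 : is_derive x 1 (fun x : R => b - x) (- 1).
  have := @is_deriveB R R R (cst b) id x 1 0 1 (is_derive_cst _ _ _) (is_derive_id _ _).
  by rewrite sub0r.
have e1 := @is_derive1_comp R (flat P) (fun x => x - a) x _ _ (is_derive_flat _ _) d1.
have e2 := @is_derive1_comp R (flat Q) (fun x => b - x) x _ _ (is_derive_flat _ _) d2.
have := @is_deriveD R R R _ _ x 1 _ _ (@is_deriveM R R _ _ x 1 _ _ e1 e2) ih.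
congr (is_derive _ _ _ _); rewrite /flat_pairs /flat_pairs_deriv /= !big_cons /=.
by rewrite flatN /GRing.scale /=; ring.
Qed.

Lemma derive1n_flat_pairs a b L n :
  derive1n n (flat_pairs a b L) = flat_pairs a b (iter n flat_pairs_deriv L).
Proof.
elim: n => // n ih; rewrite derive1nS ih; apply/funext => x.
rewrite derive1E; have h := is_derive_flat_pairs a b (iter n flat_pairs_deriv L) x.
exact: derive_val.
Qed.

Definition bump a b : R -> R := flat_pairs a b [:: (1, 1)].

Lemma bumpE a b x : bump a b x = flat 1 (x - a) * flat 1 (b - x).
Proof. by rewrite /bump /flat_pairs big_seq1. Qed.

Lemma bump_out a b x : ~~ (a <= x <= b) -> bump a b x = 0.
Proof.
rewrite negb_and -!ltNge bumpE => /orP[h|h].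
  by rewrite flat_le0 ?mul0r// subr_le0 ltW.
by rewrite [X in _ * X]flat_le0 ?mulr0// subr_le0 ltW.
Qed.

Lemma test_function_bump (T a b : R) : 0 < a -> b < T -> test_function T (bump a b).
Proof.
move=> a0 bT; split=> [n x|].
  rewrite derive1n_flat_pairs.
  by have h := is_derive_flat_pairs a b (iter n flat_pairs_deriv [:: (1, 1)]) x.
by exists a, b; split=> // x; apply: contraR => /bump_out ->.
Qed.

Lemma bump_ge0 a b x : 0 <= bump a b x.
Proof. by rewrite bumpE mulr_ge0// flat1_ge0. Qed.

Lemma bump_continuous a b : continuous (bump a b).
Proof.
by move=> x; have := is_derive_flat_pairs a b [:: (1, 1)] x; exact: is_derive_continuous.
Qed.

Lemma integrable_within (g : R -> R) (T : R) : {within `[0, T], continuous g} ->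
  mu.-integrable `[0, T] (EFin \o g).
Proof. by apply: continuous_compact_integrable; exact: segment_compact. Qed.

Lemma within_continuousM (g h : R -> R) (T : R) : {within `[0, T], continuous g} ->
  {within `[0, T], continuous h} -> {within `[0, T], continuous (fun x => g x * h x)}.
Proof. by move=> cg ch x; apply: cvgM; [exact: cg|exact: ch]. Qed.

(** One half of the fundamental lemma of the calculus of variations: if [h c > 0], a bump supported
    where [h >= h c / 2] has a positive integral against [h]. *)
Lemma test_function_integral_le0 (T : R) (h : R -> R) (c : R) :
  {within `[0, T], continuous h} ->
  (forall phi, test_function T phi -> \int[mu]_(x in `[0, T]) (h x * phi x) = 0) ->
  0 < c < T -> h c <= 0.
Proof.
move=> ch hphi /andP[c0 cT]; rewrite leNgt; apply/negP => hc.
have hcont : {for c, continuous h}.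
  move: ch => /continuous_within_itvP => /(_ (lt_trans c0 cT))[ch _ _].
  by apply: ch; rewrite in_itv /= c0 cT.
have hc2 : 0 < h c / 2 by rewrite divr_gt0.
move/cvgrPdist_lt : hcont => /(_ _ hc2) /nbhs_ballP[D /= D0 hD].
(* [D / 2] keeps [h] above [h c / 2] on the support; the other two bounds keep the support inside
   the open interval. *)
pose d := Num.min (D / 2) (Num.min (c / 2) ((T - c) / 2)).
have d0 : 0 < d by rewrite !lt_min !divr_gt0// subr_gt0.
have dD : d <= D / 2 by rewrite ge_min lexx.
have dc : d <= c / 2 by rewrite !ge_min lexx orbT.
have dT : d <= (T - c) / 2 by rewrite !ge_min lexx !orbT.
clearbody d.
have hpos x : c - d <= x <= c + d -> h c / 2 <= h x.
  move=> /andP[x1 x2]; have : `|c - x| < D.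
    by rewrite ltr_norml; apply/andP; split; lra.
  by move=> /hD /=; rewrite ltr_norml => /andP[_]; lra.
have tp : test_function T (bump (c - d) (c + d)) by apply: test_function_bump; lra.
have := hphi _ tp; set phi := bump _ _.
(* The middle half of the support, where the bump is at least [delta]. *)
pose J := (`[c - d / 2, c + d / 2]%classic : set R).
have cphi : {within `[0, T], continuous phi}.
  by apply: continuous_subspaceT; exact: bump_continuous.
have ihp : mu.-integrable `[0, T] (EFin \o (fun x => h x * phi x)).
  by apply: integrable_within; exact: within_continuousM.
have hp0 x : 0 <= h x * phi x.
  have [/hpos hx|out] := boolP (c - d <= x <= c + d).
    by rewrite mulr_ge0 ?bump_ge0//; apply: le_trans hx; exact: ltW.
  by rewrite /phi bump_out// mulr0.
pose delta := flat 1 (d / 2) * flat 1 (d / 2).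
have delta0 : 0 < delta by rewrite mulr_gt0// flat1_gt0 ?divr_gt0.
have mono s t : s <= t -> flat 1 s <= flat 1 t.
  move=> st; rewrite !flat1E; case: ifPn => s0; last by case: ifP => // _; exact: expR_ge0.
  have t0 := lt_le_trans s0 st.
  by rewrite t0 ler_expR lerN2 lef_pV2.
have phid x : J x -> delta <= phi x.
  rewrite /J /= in_itv /= => /andP[x1 x2]; rewrite /phi bumpE.
  by apply: ler_pM; rewrite ?flat1_ge0//; apply: mono; lra.
have JT : J `<=` `[0, T].
  by move=> x; rewrite /J /= !in_itv /= => /andP[x1 x2]; apply/andP; split; lra.
have mJ : measurable J by exact: measurable_itv.
have mT : measurable (`[0, T]%classic : set R) by exact: measurable_itv.
pose I := (`[0, T]%classic : set R).
have : (0 < \int[mu]_(x in I) (h x * phi x)%:E)%E.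
  apply: (@lt_le_trans _ _ (\int[mu]_(x in J) (h x * phi x)%:E)%E); last first.
    apply: ge0_subset_integral => //; first by case/integrableP : ihp.
    by move=> x _; rewrite lee_fin.
  apply: (@lt_le_trans _ _ (\int[mu]_(x in J) (h c / 2 * delta)%:E)%E).
    have muJ : mu J = d%:E.
      rewrite /J lebesgue_measure_itv /= lte_fin ifT; last by lra.
      by rewrite -EFinB; congr EFin; lra.
    rewrite integral_cst// [X in (_ * X)%E](_ : _ = d%:E); last exact: muJ.
    by rewrite -EFinM lte_fin; apply: mulr_gt0 => //; exact: mulr_gt0.
  apply: ge0_le_integral => //.
  - by move=> x _; rewrite lee_fin mulr_ge0 ?ltW.
  - apply: (measurable_funS mT JT).
    by case/integrableP : ihp.
  - move=> x Jx; rewrite lee_fin; apply: ler_pM; [exact: ltW|exact: ltW| |exact: phid].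
    apply: hpos; move: Jx; rewrite /J /= in_itv /= => /andP[x1 x2].
    by apply/andP; split; lra.
have fi : (\int[mu]_(x in I) (h x * phi x)%:E)%E \is a fin_num.
  exact: integrable_fin_num.
rewrite -(fineK fi) lte_fin => h1 h0.
have : 0 < \int[mu]_(x in `[0, T]) (h x * phi x) := h1.
by rewrite h0 ltxx.
Qed.

End TestFunctions.

(** * Weak derivatives of analytic functions *)

Section WeakDerivatives.
Context {R : realType}.
Implicit Types (T x : R) (f : R[i] -> R[i]).
Local Notation mu := (@lebesgue_measure R).

Lemma eq_Rintegral0T T (g h : R -> R) : (forall x, 0 <= x <= T -> g x = h x) ->
  \int[mu]_(x in `[0, T]) g x = \int[mu]_(x in `[0, T]) h x.
Proof. by move=> gh; apply: eq_Rintegral => x; rewrite inE /= in_itv; exact: gh. Qed.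

Lemma test_function_orthogonal_eq0 T (h : R -> R) : 0 < T ->
  {within `[0, T], continuous h} ->
  (forall phi, test_function T phi -> \int[mu]_(x in `[0, T]) (h x * phi x) = 0) ->
  forall x, 0 <= x <= T -> h x = 0.
Proof.
move=> T0 ch hphi.
have chN : {within `[0, T], continuous (fun x => - h x)}.
  by move=> x; apply: cvgN; exact: ch.
have cphi phi : test_function T phi -> {within `[0, T], continuous phi}.
  move=> [tp _]; apply: continuous_subspaceT => x.
  by apply/differentiable_continuous/derivable1_diffP; exact: (tp 0%N x).
have hphiN phi : test_function T phi -> \int[mu]_(x in `[0, T]) (- h x * phi x) = 0.
  move=> tp; rewrite (@eq_Rintegral0T T _ (fun x => -1 * (h x * phi x))); last first.
    by move=> x _; rewrite mulN1r mulNr.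
  rewrite RintegralZl ?hphi ?mulr0//.
  by apply: integrable_within; apply: within_continuousM => //; exact: cphi.
have oo x : 0 < x < T -> h x = 0.
  move=> xT; have h1 := test_function_integral_le0 ch hphi xT.
  have := test_function_integral_le0 chN hphiN xT.
  by rewrite oppr_le0 => h2; apply/eqP; rewrite eq_le h1 h2.
have [_ h0 hT] := (continuous_within_itvP h T0).1 ch.
have l0 : h t @[t --> 0^'+] --> (0 : R).
  apply: cvg_near_cst; near=> t; apply: oo; apply/andP; split; near: t.
    exact: nbhs_right_gt.
  exact: nbhs_right_lt.
have lT : h t @[t --> T^'-] --> (0 : R).
  apply: cvg_near_cst; near=> t; apply: oo; apply/andP; split; near: t.
    exact: nbhs_left_gt.
  exact: nbhs_left_lt.
have e0 : h 0 = 0 by exact: cvg_unique h0 l0.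
have eT : h T = 0 by exact: cvg_unique hT lT.
move=> x /andP[]; rewrite le_eqVlt => /predU1P[<-//|x0].
by rewrite le_eqVlt => /predU1P[->//|xT]; apply: oo; rewrite x0.
Unshelve. all: by end_near. Qed.

(** Integration by parts, without boundary terms since [phi] vanishes at [0] and [T], makes [v - p']
    orthogonal to all test functions. Continuity of [v] extends the equality to the endpoints, where
    periodicity is read. *)
Lemma weak_derivative_classical T (p p' u v : R -> R) : 0 < T ->
  (forall x, 0 <= x <= T -> is_derive x 1 p (p' x)) ->
  (forall x, 0 <= x <= T -> {for x, continuous p'}) ->
  (forall x, 0 <= x <= T -> u x = p x) ->
  {within `[0, T], continuous v} ->
  (forall phi, test_function T phi ->
    \int[mu]_(x in `[0, T]) (u x * derive1 phi x) =
    - \int[mu]_(x in `[0, T]) (v x * phi x)) ->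
  forall x, 0 <= x <= T -> v x = p' x.
Proof.
move=> T0 dp cp' up cv weak x xT; apply/eqP; rewrite -subr_eq0; apply/eqP.
have cwp' : {within `[0, T], continuous p'}.
  by apply: continuous_in_subspaceT => t; rewrite inE /= in_itv /=; exact: cp'.
move: x xT; apply: (@test_function_orthogonal_eq0 T (fun x => v x - p' x)) => //.
  by move=> t; apply: cvgB; [exact: cv|exact: cwp'].
move=> phi tp; have [dphi [a [b [a0 bT supp]]]] := tp.
have dphi1 (t : R) : is_derive t 1 phi (derive1 phi t).
  by split; [exact: (dphi 0%N t)|rewrite derive1E].
have cphi : continuous phi by move=> t; exact: is_derive_continuous (dphi1 t).
have cdphi : continuous (derive1 phi).
  by move=> t; apply/differentiable_continuous/derivable1_diffP; exact: (dphi 1%N t).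
have phi0 : phi 0 = 0.
  by apply/eqP; apply: contraT => /supp /andP[+ _]; rewrite leNgt a0.
have phiT : phi T = 0.
  by apply/eqP; apply: contraT => /supp /andP[_ +]; rewrite leNgt bT.
have [P1 P2] := is_derive_LRcontinuous T0 dp.
have [G1 G2] := is_derive_LRcontinuous T0 (fun t _ => dphi1 t).
have := Rintegration_by_parts T0 cwp' P1 P2 (continuous_subspaceT cdphi) G1 G2.
rewrite phi0 phiT !mulr0 subrr sub0r => parts.
have cwphi : {within `[0, T], continuous phi} by exact: continuous_subspaceT.
rewrite (@eq_Rintegral0T T _ (fun x => v x * phi x - p' x * phi x)); last first.
  by move=> t _; rewrite mulrBl.
rewrite RintegralB//; last 2 first.
- by apply: integrable_within; exact: within_continuousM.
- by apply: integrable_within; exact: within_continuousM.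
apply/eqP; rewrite subr_eq0 -eqr_opp -weak// -parts; apply/eqP.
by apply: eq_Rintegral => t; rewrite inE /= in_itv /= => tT; rewrite up.
Qed.

Lemma near_cabs (z : R[i]^o) (e : R) : 0 < e ->
  \forall w \near z, cabs (z - w) < e.
Proof.
by move=> e0; apply/nbhs_normP; exists e%:C => [|w] /=; rewrite -?cabsE ltcR.
Qed.

Lemma continuous_Re : continuous (fun z : R[i]^o => complex.Re z : R).
Proof.
move=> z; have FF : Filter (nbhs (z : R[i]^o)) by exact: nbhs_filter.
apply/(@cvgrPdist_lt _ _ _ (nbhs (z : R[i]^o)) FF) => e e0.
apply: filterS (near_cabs z e0) => w /=; apply: le_lt_trans.
by rewrite -ReB; exact: Re_le_cabs.
Qed.

Lemma continuous_Im : continuous (fun z : R[i]^o => complex.Im z : R).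
Proof.
move=> z; have FF : Filter (nbhs (z : R[i]^o)) by exact: nbhs_filter.
apply/(@cvgrPdist_lt _ _ _ (nbhs (z : R[i]^o)) FF) => e e0.
apply: filterS (near_cabs z e0) => w /=; apply: le_lt_trans.
by rewrite -ImB; exact: Im_le_cabs.
Qed.

Lemma HT_derivative_step T (F F' F'' : R[i] -> R[i]) (u v : R -> R[i]) : 0 < T ->
  (forall x, 0 <= x <= T -> hol F x%:C (F' x%:C) /\ hol F' x%:C (F'' x%:C)) ->
  (forall x, 0 <= x <= T -> u x = F x%:C) ->
  {within `[0, T], continuous (v : R -> R[i]^o)} ->
  weak_derivative T u v ->
  forall x, 0 <= x <= T -> v x = F' x%:C.
Proof.
move=> T0 hF uF cv weak x xT.
have cvRe : {within `[0, T], continuous (fun x => complex.Re (v x))}.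
  by move=> t; apply: (continuous_comp (cv t)); exact: continuous_Re.
have cvIm : {within `[0, T], continuous (fun x => complex.Im (v x))}.
  by move=> t; apply: (continuous_comp (cv t)); exact: continuous_Im.
have ReMr (z : R[i]) (r : R) : complex.Re (z * r%:C) = complex.Re z * r.
  by rewrite mulrC ReZ mulrC.
have ImMr (z : R[i]) (r : R) : complex.Im (z * r%:C) = complex.Im z * r.
  by rewrite mulrC ImZ mulrC.
apply: complex_eq.
- move: x xT; apply: (@weak_derivative_classical T (fun x => complex.Re (F x%:C))
    (fun x => complex.Re (F' x%:C)) (fun x => complex.Re (u x))) => //.
  + move=> t tT; have [h _] := hF t tT; exact: (@hol_Re_horizontal R F t 0).
  + move=> t tT; have [_ /hol_ccont h] := hF t tT; exact: (@ccont_Re_horizontal R F' t 0).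
  + by move=> t tT; rewrite uF.
  + move=> phi /weak /(congr1 (@complex.Re R)) /= h.
    transitivity (\int[mu]_(x in `[0, T]) complex.Re (u x * (derive1 phi x)%:C)).
      by apply: eq_Rintegral0T => t _; rewrite ReMr.
    apply: (etrans h); congr (- _); apply: eq_Rintegral0T => t _; exact: ReMr.
- move: x xT; apply: (@weak_derivative_classical T (fun x => complex.Im (F x%:C))
    (fun x => complex.Im (F' x%:C)) (fun x => complex.Im (u x))) => //.
  + move=> t tT; have [/(holZ (- 'i%C)) h _] := hF t tT.
    have := @hol_Re_horizontal R _ t 0 _ h; rewrite ReNi.
    by under eq_fun do rewrite ReNi.
  + move=> t tT; have [_ /hol_ccont /(ccontZ (- 'i%C)) h] := hF t tT.
    have := @ccont_Re_horizontal R _ t 0 h.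
    by rewrite /prop_for (_ : (fun s : R => _) = fun s => complex.Im (F' s%:C))//;
      apply/funext => s; rewrite ReNi.
  + by move=> t tT; rewrite uF.
  + move=> phi /weak /(congr1 (@complex.Im R)) /= h.
    transitivity (\int[mu]_(x in `[0, T]) complex.Im (u x * (derive1 phi x)%:C)).
      by apply: eq_Rintegral0T => t _; rewrite ImMr.
    apply: (etrans h); congr (- _); apply: eq_Rintegral0T => t _; exact: ImMr.
Qed.

(** Starting from [D 0 = f], each weak derivative is identified with the next complex derivative,
    which then inherits its endpoint equality. *)
Lemma HToo_derivatives T (fs : nat -> R[i] -> R[i]) : 0 < T ->
  (forall j x, 0 <= x <= T -> hol (fs j) x%:C (fs j.+1 x%:C)) ->
  HToo T (fun x => fs 0%N x%:C) ->
  forall j, fs j 0 = fs j T%:C.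
Proof.
(* Order [j.+1], because continuity and endpoint values are available only strictly below the top
   order. *)
move=> T0 hfs hH j; have [D [D0 _ weak _ cD]] := hH j.+1.
have DE i : (i <= j)%N -> forall x, 0 <= x <= T -> D i x = fs i x%:C.
  elim: i => [_ x xT|i ih ij]; first by apply: D0; rewrite in_itv.
  apply: (@HT_derivative_step T (fs i) (fs i.+1) (fs i.+2) (D i)) => //.
  - by move=> x xT; split; exact: hfs.
  - by apply: ih; exact: ltnW.
  - by have [] := cD i.+1 ij.
  - by apply: weak; exact: leq_trans ij (leqnSn j).
have [_ per] := cD j (ltnSn j).
by rewrite -[0]/((0 : R)%:C) -!DE ?lexx ?(ltW T0)//.
Qed.

End WeakDerivatives.

(** * Periodicity on the strip *)

Section IdentityTheorem.
Context {R : realType}.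
Implicit Types (T x y c : R) (f : R[i] -> R[i]) (U : set R[i]).

(** Connectedness of [[- c, c]]: the heights at which all derivatives agree on both edges form a set
    containing 0, relatively open by [iter_cderive_eq_near], and closed by continuity of each
    derivative. Agreement of [f] alone would not give openness. *)
Lemma has_series_on_periodic U f T c : 0 <= T -> 0 <= c -> has_series_on U f ->
  (forall z, 0 <= complex.Re z <= T -> - c <= complex.Im z <= c -> U z) ->
  (forall j, iter j cderive f 0 = iter j cderive f T%:C) ->
  forall y, - c <= y <= c -> f (0 +i* y) = f (T +i* y).
Proof.
move=> T0 c0 fU SU per0.
pose I : set R := [set y | - c <= y <= c].
pose B : set R := I `&`
  [set y | forall j, iter j cderive f (0 +i* y) = iter j cderive f (T +i* y)].
have UI x y : 0 <= x <= T -> I y -> U (x +i* y).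
  by move=> xT yI; apply: SU.
have x0 : 0 <= (0 : R) <= T by rewrite lexx.
have xT : 0 <= T <= T by rewrite T0 lexx.
have shift x y y' : x +i* y' = x +i* y + (0 +i* (y' - y)).
  by simpc; rewrite subrKC.
have cabs_iy (y : R) : cabs (0 +i* y) <= `|y|.
  by apply: le_trans (cabs_le _) _; rewrite /= normr0 add0r.
suff : B = I by move=> BI y yI; have [_ /(_ 0%N)] : B y by rewrite BI.
have cI : connected I.
  have -> : I = [set` `[- c, c]] by apply/seteqP; split=> y; rewrite /I /= in_itv.
  exact: segment_connected.
apply: cI.
- by exists 0; split=> //; rewrite /I /= oppr_le0 c0.
- exists (interior [set y | I y -> B y]); first exact: open_interior.
  apply/seteqP; split=> y.
    move=> By; split; first by case: By.
    have [yI hy] := By.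
    have [r r0 hr] := iter_cderive_eq_near (fU _ (UI _ _ x0 yI)) (fU _ (UI _ _ xT yI)) hy.
    apply/nbhs_ballP; exists r => //= y'; rewrite /ball /= distrC => yy' y'I.
    split=> // j; rewrite (shift 0 y) (shift T y).
    by apply: hr; apply: le_lt_trans yy'; exact: cabs_iy.
  by case=> yI /interior_subset; apply.
- exists (closure B); first exact: closed_closure.
  apply/seteqP; split=> y; first by move=> By; split; [case: By|exact: subset_closure].
  move=> [yI cB]; split=> // j; apply: cabs_small_eq => e e0.
  have e2 : 0 < e / 2 by rewrite divr_gt0.
  have cc x : 0 <= x <= T -> ccont (iter j cderive f) (x +i* y).
    move=> xT'; apply: hol_ccont.
    exact: (has_series_on_hol (has_series_on_iter j fU) (UI _ _ xT' yI)).
  have [D1 D10 h1] := cc 0 x0 _ e2; have [D2 D20 h2] := cc T xT _ e2.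
  have m0 : 0 < Num.min D1 D2 by rewrite lt_min D10.
  have [y' [[y'I By'] /=]] := cB _ (nbhsx_ballx y _ m0).
  rewrite /ball /= distrC lt_min => /andP[yD1 yD2].
  have := h1 (0 +i* (y' - y)) (le_lt_trans (cabs_iy _) yD1).
  have := h2 (0 +i* (y' - y)) (le_lt_trans (cabs_iy _) yD2).
  rewrite -!shift By'.
  set p := iter j cderive f (T +i* y'); 
  set a := iter j cderive f (0 +i* y); set b := iter j cderive f (T +i* y).
  move=> H2 H1; have -> : a - b = (p - b) - (p - a) by ring.
  by apply: le_trans (cabsB _ _) _; lra.
Qed.

End IdentityTheorem.

(** * Lebesgue norms *)

Section Norms.
Context {R : realType}.
Implicit Types (T x y b c M : R) (f : R[i] -> R[i]).
Local Notation mu := (@lebesgue_measure R).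

Lemma L2norm_le T (u : R -> R[i]) (E : R) : 0 <= T -> 0 <= E ->
  measurable_fun `[0, T] (fun x => cabs (u x)) ->
  (forall x, 0 <= x <= T -> cabs (u x) <= E) ->
  (L2norm T u <= (E * Num.sqrt T)%:E)%E.
Proof.
move=> T0 E0 mu_ uE.
have mI : measurable (`[0, T]%classic : set R) by exact: measurable_itv.
have muI : mu `[0, T]%classic = T%:E.
  rewrite lebesgue_measure_itv /= lte_fin; case: ltP => [_|T0'].
    by rewrite oppr0 adde0.
  by congr EFin; apply/eqP; rewrite eq_le T0 T0'.
have patchE : (fun x => (`|((fun x => (cabs (u x))%:E) \_ `[0%R, T]) x| `^ 2)%E) =
    ((fun x => (cabs (u x) ^+ 2)%:E) \_ `[0%R, T]).
  apply/funext => x; rewrite !patchE; case: ifPn => _.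
    by rewrite gee0_abs ?lee_fin ?cabs_ge0// poweR_EFin powR_mulrn// cabs_ge0.
  by rewrite abse0 poweR_EFin powR0.
rewrite /L2norm unlock patchE -integral_mkcond.
set I2 := (\int[_]_(x in _) _)%E.
have I20 : (0 <= I2)%E by apply: integral_ge0 => x _; rewrite lee_fin exprn_ge0// cabs_ge0.
have I2E : (I2 <= (E ^+ 2 * T)%:E)%E.
  apply: (@le_trans _ _ (\int[mu]_(x in `[0%R, T]) (E ^+ 2)%:E)%E).
    apply: ge0_le_integral => //.
    - by move=> x _; rewrite lee_fin exprn_ge0// cabs_ge0.
    - by apply/measurable_EFinP; exact: measurable_funX.
    - move=> x; rewrite /= in_itv /= => xT; rewrite lee_fin.
      by apply: lerXn2r; rewrite ?nnegrE ?cabs_ge0//; exact: uE.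
  rewrite integral_cst// [X in (_ * X)%E](_ : _ = T%:E); last exact: muI.
  by rewrite -EFinM.
have -> : (E * Num.sqrt T)%:E = ((E ^+ 2 * T)%:E `^ 2^-1)%E.
  rewrite poweR_EFin powR12_sqrt; last by rewrite mulr_ge0// sqr_ge0.
  by rewrite sqrtrM ?sqr_ge0// sqrtr_sqr ger0_norm.
have ET0 : (0 <= (E ^+ 2 * T)%:E)%E by rewrite lee_fin mulr_ge0// sqr_ge0.
apply: gt0_ler_poweR => //.
- by rewrite in_itv /= I20 leey.
- by rewrite in_itv /= ET0 leey.
Qed.

(** If [|f z| > M], continuity would put a rectangle of positive measure inside the exceptional null
    set. *)
Lemma Anorm_ge T c f M : 0 < T -> 0 < c ->
  (forall z, 0 <= complex.Re z <= T -> - c <= complex.Im z <= c -> ccont f z) ->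
  (Anorm T c f <= M%:E)%E ->
  forall z, 0 <= complex.Re z <= T -> - c <= complex.Im z <= c -> cabs (f z) <= M.
Proof.
move=> T0 c0 cf fM z zT zc; rewrite leNgt; apply/negP => Mfz.
(* The image of the whole strip under the homothety of center [z] and ratio [k]. For [k <= 1] it
   stays in the strip, even when [z] is on the boundary. *)
pose Q k : set (R * R) :=
  `[complex.Re z - k * complex.Re z, complex.Re z + k * (T - complex.Re z)] `*`
  `[complex.Im z - k * (complex.Im z + c), complex.Im z + k * (c - complex.Im z)].
have mitv (a b : R) : measurable (`[a, b]%classic : set R) by exact: measurable_itv.
have mitvE (a b : R) : a < b -> mu `[a, b]%classic = (b - a)%:E.
  by move=> ab; rewrite lebesgue_measure_itv /= lte_fin ab EFinB.
have muQ k : 0 < k -> (mu \x mu)%E (Q k) = (k * T * (k * (2 * c)))%:E.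
  move=> k0; rewrite product_measure1E//.
  rewrite [X in (X * _)%E](_ : _ = (k * T)%:E); last first.
    by apply: (etrans (mitvE _ _ _)); [nra|congr EFin; ring].
  rewrite [X in (_ * X)%E](_ : _ = (k * (2 * c))%:E); last first.
    by apply: (etrans (mitvE _ _ _)); [nra|congr EFin; ring].
  by rewrite -EFinM.
have muQ0 k : 0 < k -> (0 < (mu \x mu)%E (Q k))%E.
  by move=> k0; rewrite muQ// lte_fin !mulr_gt0.
(* The norm of order [+oo] is the essential supremum once the whole space is known to have positive
   measure. *)
have mT0 : (0 < (mu \x mu)%E setT)%E.
  apply: lt_le_trans (muQ0 1 ltr01) _; apply: le_measure; rewrite ?inE//;
    exact: measurableX.

move: fM; rewrite /Anorm unlock mT0 => /ess_supP [N [mN N0 sub]].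
have e0 : 0 < (cabs (f z) - M) / 2 by rewrite divr_gt0// subr_gt0.
have [D D0 hD] := cf z zT zc _ e0.
pose k := Num.min 1 (D / (2 * (T + 2 * c))).
have Tc0 : 0 < T + 2 * c by lra.
have k0 : 0 < k by rewrite lt_min ltr01 divr_gt0// mulr_gt0.
have k1 : k <= 1 by rewrite ge_min lexx.
have kD : k * (T + 2 * c) < D.
  have : k <= D / (2 * (T + 2 * c)) by rewrite ge_min lexx orbT.
  by rewrite ler_pdivlMr ?mulr_gt0//; lra.
clearbody k.
have QN : Q k `<=` N.
  move=> [s y] [/=]; rewrite !in_itv /= => /andP[s1 s2] /andP[y1 y2].
  apply: sub => /=; rewrite patchE mem_set /=; last first.
    split; rewrite /= in_itv /=; apply/andP; split; nra.
  rewrite ger0_norm ?cabs_ge0// lee_fin; apply/negP; rewrite -ltNge.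
  have h : cabs ((s - complex.Re z) +i* (y - complex.Im z)) < D.
    apply: le_lt_trans kD; apply: le_trans (cabs_le _) _ => /=.
    rewrite mulrDr; apply: lerD; rewrite ler_norml; apply/andP; split; nra.
  have := hD _ h.
  rewrite (_ : z + _ = s +i* y); last first.
    by apply: complex_eq; rewrite ?ReD ?ImD /= subrKC.
  by have := cabs_lerB (f z) (f (s +i* y)); rewrite cabsC; lra.
have : ((mu \x mu)%E (Q k) <= (mu \x mu)%E N)%E 
  by apply: le_measure; rewrite ?inE//; exact: measurableX.
by rewrite N0 leNgt muQ0.
Qed.

End Norms.

(** * Uniform estimate of the remainder *)

Section UniformError.
Context {R : realType}.
Implicit Types (T x y b c M : R) (f : R[i] -> R[i]) (U : set R[i]).

Lemma analytic_near_has_series_on (S : set R[i]) f : analytic_near S f ->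
  exists2 U, S `<=` U & has_series_on U f.
Proof.
by move=> [U [_ SU fU]]; exists U => // z; exact: analytic_in_has_series.
Qed.

Lemma hol_sum n (F : 'I_n -> R[i] -> R[i]) z :
  (forall j, exists d, hol (F j) z d) -> exists d, hol (fun w => \sum_(j < n) F j w) z d.
Proof.
elim: n F => [|n ih] F hF.
  exists 0; rewrite (_ : (fun _ => _) = fun=> 0); first exact: hol_cst.
  by apply/funext => w; rewrite big_ord0.
have [d1 h1] := ih (fun j => F (widen_ord (leqnSn n) j)) (fun j => hF _).
have [d2 h2] := hF ord_max; exists (d1 + d2).
rewrite (_ : (fun _ => _) = fun w =>
  \sum_(j < n) F (widen_ord (leqnSn n) j) w + F ord_max w); first exact: holD.
by apply/funext => w; rewrite big_ord_recr.
Qed.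

(** With the modes extended to complex arguments, the rules for [hol] give the continuity used for
    measurability and at the endpoints. *)
Lemma fourier_remainder_ccont T N f x : (exists d, hol f x%:C d) ->
  ccont (fun z => f z - \sum_(j < N.+1) fourier_coef T (fun t => f t%:C) (freq j) *
    cexpi (omega T (freq j)%:~R) z) x%:C.
Proof.
move=> [d hd].
have [d' hd'] := @hol_sum N.+1 (fun j z => fourier_coef T (fun t => f t%:C) (freq j) *
    cexpi (omega T (freq j)%:~R) z) x%:C
  (fun j => ex_intro _ _ (holZ _ (hol_cexpi _ _))).
exact: hol_ccont (holB hd hd').
Qed.

Lemma real_shift x t : t%:C = x%:C + (t - x)%:C :> R[i].
Proof. by rewrite -rmorphD /= subrKC. Qed.

Lemma fourier_remainderE T N f x : f x%:C - fourier_trunc T N (fun t => f t%:C) x =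
  f x%:C - \sum_(j < N.+1) fourier_coef T (fun t => f t%:C) (freq j) *
    cexpi (omega T (freq j)%:~R) x%:C.
Proof.
by congr (_ - _); apply: eq_bigr => j _; rewrite cexpi_real.
Qed.

Lemma periodic_derivatives T U f : 0 < T -> has_series_on U f ->
  (forall x, 0 <= x <= T -> U x%:C) -> HToo T (fun x => f x%:C) ->
  forall j, iter j cderive f 0 = iter j cderive f T%:C.
Proof.
move=> T0 fU UT fH; apply: (@HToo_derivatives R T (fun j => iter j cderive f) T0) => //.
move=> j x xT; exact: has_series_on_hol (has_series_on_iter j fU) (UT x xT).
Qed.

(* Shifting the contour by [b' = b n/(n+1)] instead of [b] keeps it inside the
   open strip, and the spare power of [r] in [fourier_error] makes up for it. *)
Lemma fourier_uniform_error T U f b M N : 0 < T -> 0 < b -> (0 < N)%N -> ~~ odd N ->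
  has_series_on U f -> strip T b `<=` U -> HToo T (fun x => f x%:C) ->
  (forall z, strip T b z -> cabs (f z) <= M) ->
  forall x, 0 <= x <= T ->
  cabs (f x%:C - fourier_trunc T N (fun t => f t%:C) x) <=
    8 * M * expR (- omega T (N%:R * b / 2)) / (1 - expR (- omega T (b / 2))).
Proof.
move=> T0 b0 N0 evN fU SU fH fM x xT; set E := (X in _ <= X).
have UT t : 0 <= t <= T -> U t%:C.
  by move=> tT; apply: SU; split=> //=; apply/andP; split; lra.
have per := has_series_on_periodic (ltW T0) (ltW b0) fU
  (fun z zT zb => SU z (conj zT zb)) (periodic_derivatives T0 fU UT fH).
have hf z : 0 <= complex.Re z <= T -> - b <= complex.Im z <= b ->
    [/\ hol f z (cderive f z), hol (cderive f) z (cderive (cderive f) z) & cabs (f z) <= M].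
  move=> zT zb; have zU : U z by apply: SU.
  split; [exact: has_series_on_hol zU|exact: has_series_on_hol (has_series_on_iter 1 fU) zU|].
  exact: fM.
pose n := N./2.
have NE : N = n.*2 by rewrite -[N in LHS]odd_double_half (negbTE evN).
have n0 : (0 < n)%N by move: N0; rewrite NE double_gt0.
have n1 : 1 <= n%:R :> R by rewrite ler1n.
pose b' := b * n%:R / n.+1%:R.
have nS0 : 0 < n.+1%:R :> R by rewrite ltr0n.
have nSE : n.+1%:R = n%:R + 1 :> R by rewrite natr1.
have b'b : b' < b by rewrite /b' ltr_pdivrMr// ltr_pM2l// ltr_nat.
(* As [n >= 1], this makes the denominator of the bound independent of [N]. *)
have b'2 : b / 2 <= b' by rewrite /b' ler_pdivlMr// nSE; nra.
have b'0 : 0 < b' by apply: lt_le_trans b'2; rewrite divr_gt0.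
have M0 : 0 <= M.
  apply: le_trans (fM 0 _); first exact: cabs_ge0.
  by split=> /=; [rewrite lexx ltW|apply/andP; split; lra].
pose r := expR (- omega T b').
have wmono s t : s <= t -> omega T s <= omega T t.
  move=> st; rewrite /omega; apply: ler_wpM2r; first by rewrite invr_ge0 ltW.
  by apply: ler_wpM2l => //; rewrite mulr_ge0// pi_ge0.
have rle : r <= expR (- omega T (b / 2)) by rewrite ler_expR lerN2 wmono.
have q1 : expR (- omega T (b / 2)) < 1.
  by rewrite -[ltRHS]expR0 ltr_expR oppr_lt0 omega_gt0// divr_gt0.
have rE : r ^+ n.+1 = expR (- omega T (N%:R * b / 2)).
  rewrite /r -expRM_natl; congr expR; rewrite /b' /omega NE -mul2n natrM nSE.
  by field; rewrite gt_eqF//= gt_eqF//; lra.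
have inner t : 0 < t < T ->
    cabs (f t%:C - fourier_trunc T N (fun s => f s%:C) t) <= E.
  move=> tT; have b'bb : 0 < b' < b by rewrite b'0.
  apply: le_trans (fourier_error T0 b'bb evN hf per tT) _.
  rewrite -/n -/r rE /E; apply: ler_wpM2l.
    by rewrite !mulr_ge0// expR_ge0.
  by rewrite lef_pV2 ?posrE ?subr_gt0//; lra.
(* Up to an error [e], the value at [x] is replaced by that at an interior point [t], obtained by
   moving [x] slightly towards the midpoint [T / 2]; this covers the endpoints. *)
apply/ler_addgt0Pr => e e0.
have hx : exists d, hol f x%:C d.
  by exists (cderive f x%:C); exact: has_series_on_hol (UT x xT).
have [D D0 hD] := fourier_remainder_ccont T N hx e0.
pose k := Num.min (1 / 2) (D / (2 * T)).
have k0 : 0 < k by rewrite lt_min !divr_gt0// mulr_gt0.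
have k1 : k <= 1 / 2 by rewrite ge_min lexx.
have kD : k * T < D.
  have : k <= D / (2 * T) by rewrite ge_min lexx orbT.
  by rewrite ler_pdivlMr ?mulr_gt0//; lra.
clearbody k.
pose t := x + k * (T / 2 - x).
have tT : 0 < t < T by case/andP: xT => p q; rewrite /t; apply/andP; split; nra.
have tD : cabs ((t - x)%:C : R[i]) < D.
  rewrite cabsR; apply: le_lt_trans kD; case/andP: xT => p q.
  by rewrite /t ler_norml; apply/andP; split; nra.
have := hD _ tD; rewrite -real_shift -!fourier_remainderE.
have := inner t tT.
set p := (X in cabs X <= E); set q := (X in _ -> cabs (_ - X) <= _ -> _).
move=> h1 h2; rewrite -/q; have -> : q = p - (p - q) by ring.
by apply: le_trans (cabsB _ _) _; exact: lerD.
Qed.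

Lemma measurable_fourier_remainder T N f : 0 < T ->
  (forall x, 0 <= x <= T -> exists d, hol f x%:C d) ->
  measurable_fun `[0, T]
    (fun x => cabs (f x%:C - fourier_trunc T N (fun t => f t%:C) x)).
Proof.
move=> T0 hf; apply: subspace_continuous_measurable_fun; first exact: measurable_itv.
apply: continuous_in_subspaceT => x; rewrite inE /= in_itv /= => /hf hx.
apply/cvgrPdist_le => e e0; have [D D0 hD] := fourier_remainder_ccont T N hx e0.
apply/nbhs_ballP; exists D => //= t; rewrite /ball /= distrC -cabsR => /hD.
rewrite -real_shift -!fourier_remainderE.
set p := (X in cabs (X - _) <= _); set q := (X in cabs (_ - X) <= _) => h.
have h1 := cabs_lerB p q; have h2 := cabs_lerB q p; rewrite cabsC in h2.
by rewrite ler_norml; apply/andP; split; lra.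
Qed.

End UniformError.

(** * Decay rate and vanishing of the remainder *)

Theorem theorem5p2 (R : realType) (T beta : R) (f : R[i] -> R[i])
    (T_gt0 : 0 < T) (beta_gt0 : 0 < beta) (fA : inA T beta f) :
  let g := fun x : R => f x%:C in
  (exists C : R, \forall N \near \oo, (0 < N)%N -> ~~ odd N ->
     (L2norm T (fun x => (g x - fourier_trunc T N g x)%R)
        <= (C * expR (- omega T (N%:R * beta / 2)))%:E)%E) /\
  (beta_analytic T beta f ->
   forall N : nat, (0 < N)%N -> ~~ odd N ->
     L2norm T (fun x => g x - fourier_trunc T N g x) = 0%E /\
     exists c : 'I_N.+1 -> R[i], forall x : R, 0 <= x <= T ->
       g x = \sum_(j < N.+1) c j * fourier_mode T (freq j) x).
Proof.
move=> g; have [fH /analytic_near_has_series_on[U SU fU]] := fA.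
have UT x : 0 <= x <= T -> exists d, hol f x%:C d.
  move=> xT; exists (cderive f x%:C); apply: (has_series_on_hol fU); apply: SU.
  by split=> //=; apply/andP; split; lra.
split.
- have [M hM] : exists M : R, forall z, 0 <= complex.Re z <= T ->
      - beta <= complex.Im z <= beta -> cabs (f z) <= M.
    apply: rect_bounded => z zT zb.
    have zU : U z by apply: SU.
    have [D D0 hD] := hol_ccont (has_series_on_hol fU zU) ltr01.
    exists (cabs (f z) + 1), D; split=> // h /hD.
    by have := cabs_lerB (f (z + h)) (f z); lra.
  have fM z : strip T beta z -> cabs (f z) <= M by move=> [zT zb]; exact: hM.
  have M0 : 0 <= M.
    apply: le_trans (fM 0 _); first exact: cabs_ge0.
    by split=> /=; [rewrite lexx ltW|apply/andP; split; lra].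
  pose k := (1 - expR (- omega T (beta / 2)))^-1.
  have k0 : 0 <= k.
    rewrite invr_ge0 subr_ge0 -[leRHS]expR0 ler_expR oppr_le0.
    by apply/ltW/omega_gt0 => //; rewrite divr_gt0.
  (* The bound holds for every positive even [N]; [Num.sqrt T] converts the uniform bound into an
     [L^2] bound. *)
  exists (8 * M * k * Num.sqrt T); apply: nearW => N N0 evN.
  have err := fourier_uniform_error T_gt0 beta_gt0 N0 evN fU SU fH fM.
  have := L2norm_le (ltW T_gt0) _ (measurable_fourier_remainder N T_gt0 UT) err.
  rewrite -/g => /(_ _); set E := expR _.
  rewrite (_ : 8 * M * E / _ * _ = 8 * M * k * Num.sqrt T * E); last first.
    by rewrite /k; ring.
  by apply; rewrite !mulr_ge0// expR_ge0.
- move=> [_ /analytic_near_has_series_on[V SV fV] decay] N N0 evN.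
  have zero x : 0 <= x <= T -> g x - fourier_trunc T N g x = 0.
    move=> xT; rewrite -[LHS]subr0; apply/eqP; rewrite subr_eq0; apply/eqP.
    apply: cabs_small_eq => e e0; rewrite subr0.
    (* 16 is the 8 of [fourier_uniform_error] times the bound 2 on the inverse of its
       denominator. *)
    have e16 : 0 < e / 16 by rewrite divr_gt0.
    have /decay : ereal_nbhs 0%E (fun u : \bar R => (u < (e / 16)%:E)%E).
      by apply: open_ereal_lt'; rewrite lte_fin.
    move=> [A [_ hA]].
    (* [A + 1] reaches the range of the decay hypothesis, and [T / pi] makes [omega T (c / 2)] at
       least 1, so that [q2] holds. *)
    pose c := Num.max (Num.max 1 (A + 1)) (T / pi).
    have c1 : 1 <= c by rewrite !le_max lexx.
    have cA : A < c by rewrite !lt_max ltrDl ltr01 orbT.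
    have cT : T / pi <= c by rewrite le_max lexx orbT.
    have c0 : 0 < c := lt_le_trans ltr01 c1.
    clearbody c.
    have SVc : strip T c `<=` V by move=> z [zT _]; exact: SV.
    have Ac : (Anorm T c f <= (e / 16 * expR (omega T c))%:E)%E.
      have h := ltW (hA c cA).
      by rewrite EFinM -lee_pdivrMr ?expR_gt0.
    have fM z : strip T c z -> cabs (f z) <= e / 16 * expR (omega T c).
      move=> [zT zc]; apply: (Anorm_ge T_gt0 c0 _ Ac) => // w wT wc.
      by apply: hol_ccont (has_series_on_hol fV _); exact: SVc.
    apply: le_trans (fourier_uniform_error T_gt0 c0 N0 evN fV SVc fH fM xT) _.
    have q2 : expR (- omega T (c / 2)) <= 1 / 2.
      have w1 : 1 <= omega T (c / 2).
        rewrite /omega ler_pdivlMr// mul1r.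
        by move: cT; rewrite ler_pdivrMr ?pi_gt0//; lra.
      rewrite expRN div1r lef_pV2 ?posrE ?expR_gt0//.
      by have := expR_ge1Dx (omega T (c / 2)); lra.
    (* A positive even [N] is at least 2, so [N c / 2 >= c]; at [N = 2] the allowed growth is
       matched exactly. *)
    have PS : expR (omega T c) * expR (- omega T (N%:R * c / 2)) <= 1.
      rewrite -expRD -[leRHS]expR0 ler_expR subr_le0 /omega.
      rewrite ler_pdivlMr// divfK ?gt_eqF//; apply: ler_wpM2l.
        by rewrite mulr_ge0// pi_ge0.
      have : 2 <= N%:R :> R by rewrite ler_nat; case: (N) N0 evN => [|[]].
      by move=> N2; nra.
    rewrite ler_pdivrMr; last by lra.
    set P := expR _ in PS *; set S := expR _ in PS *.
    by nra.
  split.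
    apply/eqP; rewrite eq_le; apply/andP; split; last exact: Lnorm_ge0.
    have := @L2norm_le R T _ 0 (ltW T_gt0) (lexx 0)
      (measurable_fourier_remainder N T_gt0 UT).
    by rewrite mul0r; apply=> x xT; rewrite zero// cabs0.
  exists (fun j => fourier_coef T g (freq j)) => x xT.
  by apply/eqP; rewrite -subr_eq0; apply/eqP; exact: zero.
Qed.
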